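(* There is a universal constant $c_0>0$ such that the following holds. Let $(\mathcal{X},\mu)$ be a measure space, $J\ge2$, $u_1,\dots,u_J$ measurable functions on $\mathcal{X}$ with $C_J^2:=\|\frac1J\sum_{j=1}^Ju_j^2\|_{L^\infty(\mu)}<\infty$, and $\mu_0$ a probability measure on $\mathcal{X}$ with density $p_0$ with respect to $\mu$. Let $\Sigma\in\mathbb{R}^{J\times J}$, $\Sigma_{jk}=\int u_ju_kp_0\,d\mu$, satisfy $p_-\|v\|^2\le v^T\Sigma v\le p_+\|v\|^2$ for all $v\in\mathbb{R}^J$, for some $0<p_-\le p_+$. Let $X_1,\dots,X_n$ be i.i.d. $\mu_0$ and $(\Sigma_n)_{jk}=\frac1n\sum_{i=1}^nu_j(X_i)u_k(X_i)$. If $c_0n\ge C_J^2J\ln J\,\|\Sigma\|^{-1}(p_+/p_-)^2$, then \[\mathbb{P}\big(\lambda_-\le\lambda_{\min}(\Sigma_n)\le\lambda_{\max}(\Sigma_n)\le\lambda_+\big)\ge\mathbb{P}\Big(\|\Sigma_n-\Sigma\|\le\frac{p_-}{2p_+}\|\Sigma\|\Big)\ge1-e^{1-c_0n(p_-/p_+)^2\|\Sigma\|/(C_J^2J)},\] where $\lambda_-=p_-/2$ and $\lambda_+=p_++p_-/2$.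
   Context: $\|\cdot\|$ denotes the Euclidean norm on vectors and the operator norm on matrices; $\lambda_{\min},\lambda_{\max}$ are the smallest and largest eigenvalues. *)

(* Defs.v *)
From HB Require Import structures.
From mathcomp Require Import all_boot all_order all_algebra.
From mathcomp Require Import all_classical all_reals all_analysis ess_sup_inf.
Set Implicit Arguments. Unset Strict Implicit. Unset Printing Implicit Defensive.
Import Order.TTheory GRing.Theory Num.Theory.
Import numFieldNormedType.Exports.
Local Open Scope classical_set_scope.
Local Open Scope ring_scope.

Definition vnorm (R : realType) (m : nat) (v : 'cV[R]_m) : R :=
  Num.sqrt (\sum_(i < m) v i 0 ^+ 2).

Definition opnorm (R : realType) (m n : nat) (A : 'M[R]_(m, n)) : R :=
  sup [set vnorm (A *m v) | v in [set v : 'cV[R]_n | vnorm v <= 1]].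

Definition lambda_min (R : realType) (n : nat) (A : 'M[R]_n) : R :=
  inf [set a : R | eigenvalue A a].
Definition lambda_max (R : realType) (n : nat) (A : 'M[R]_n) : R :=
  sup [set a : R | eigenvalue A a].

Definition mutually_independent (R : realType) (dO : measure_display)
  (Omega : measurableType dO) (P : probability Omega R)
  (d : measure_display) (T : measurableType d) (n : nat)
  (X : 'I_n -> Omega -> T) : Prop :=
  forall (S : {set 'I_n}) (A : 'I_n -> set T),
    (forall i, measurable (A i)) ->
    P (\bigcap_(i in [set i | i \in S]) (X i @^-1` A i)) =
    (\prod_(i in S) P (X i @^-1` A i))%E.

Definition emp_gram (R : realType) (T : Type) (J n : nat)
  (u : 'I_J -> T -> R) (X : 'I_n -> T) : 'M[R]_J :=
  \matrix_(j, k) ((n%:R)^-1 * \sum_(i < n) u j (X i) * u k (X i)).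

(* Main.v *)
Require Import Defs.
From HB Require Import structures.
From mathcomp Require Import all_boot all_order all_algebra.
From mathcomp Require Import ring lra.
From mathcomp Require Import all_classical all_reals all_analysis ess_sup_inf.
From mathcomp Require Import measurable_realfun.
Set Implicit Arguments. Unset Strict Implicit. Unset Printing Implicit Defensive.
Import Order.TTheory GRing.Theory Num.Theory.
Import numFieldNormedType.Exports.
Local Open Scope classical_set_scope.
Local Open Scope ring_scope.

(* Trace moments instead of matrix exponentials.  After replacing [u] by [0] off
   a null set, the vectors [x_i = u(X_i)] satisfy [|x_i|^2 <= L := C_J^2 J].  Put
   [Y_i = x_i x_i^T - Sigma] and [S = sum_i Y_i = n (Sigma_n - Sigma)].  In
   [E tr S^(2q+2) = sum_i E tr (Y_i S^(2q+1))] one integrates over [X_i] first,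
   comparing with an independent copy [X_i']; the trace inequality
   [tr (D (A^(2q+1) - B^(2q+1))) <= (2q+1)/2 tr (D^2 (A^(2q) + B^(2q)))],
   [D = A - B], and [(x x^T - y y^T)^2 <= 2 L (x x^T + y y^T)] give
   [E tr S^(2q+2) <= (2q+1) L E tr ((S + 2 n Sigma) S^(2q))].  Bounding
   [2 tr S^(2q+1)] by [tr S^(2q+2) / a + a tr S^(2q)] with [a = (2q+1) L] yields
   [E tr S^(2q+2) <= (a^2 + 4 n a |Sigma|) E tr S^(2q)].  Iterating and applying
   Markov's inequality to [tr S^(2p) >= |S|^(2p)], with [p] of the order of
   [n |Sigma| (p_- / p_+)^2 / L], gives the tail bound.  On the event
   [|Sigma_n - Sigma| <= (p_- / (2 p_+)) |Sigma|] the quadratic form of [Sigma_n]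
   is within [p_- / 2] of that of [Sigma], because [|Sigma| <= p_+]. *)

(** * Trace inequalities *)

Definition quad (R : realFieldType) (n : nat) (A : 'M[R]_n) (v : 'cV[R]_n) : R :=
  (v^T *m A *m v) 0 0.

Definition psd (R : realFieldType) (n : nat) (A : 'M[R]_n) : Prop :=
  forall v, 0 <= quad A v.

(** Convexity and [f 0 <= 0] make [f i / i] nondecreasing ([chord], with denominators cleared), so
    the sign of [f q] passes down one index at a time. *)
Lemma le0_of_discrete_convex (R : realFieldType) (f : nat -> R) (q : nat) :
  f 0%N <= 0 -> f q <= 0 ->
  (forall i, (i.+1 < q)%N -> 2 * f i.+1 <= f i + f i.+2) ->
  forall i, (i <= q)%N -> f i <= 0.
Proof.
move=> f0 fq cvx.
have chord i : (i < q)%N -> i.+1%:R * f i <= i%:R * f i.+1.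
  elim: i => [|i IH] iq; first by rewrite mul1r mul0r.
  have := IH (ltnW iq); have := cvx i iq.
  move=> /(ler_wpM2l (ler0n R i.+1)); rewrite -!natr1; lra.
suff H j : (j <= q)%N -> f (q - j)%N <= 0.
  by move=> i iq; rewrite -(subKn iq); apply: H; rewrite leq_subr.
elim: j => [|j IH] jq; first by rewrite subn0.
have lt : (q - j.+1 < q)%N by rewrite ltn_subrL /= (leq_trans _ jq).
have eqS : (q - j)%N = (q - j.+1).+1 by rewrite -subSn// subSS.
have := chord _ lt; have := IH (ltnW jq); rewrite eqS.
move: (q - j.+1)%N => k fk ck.
rewrite -(pmulr_rle0 _ (ltr0Sn R k)); apply: le_trans ck _.
by rewrite mulr_ge0_le0.
Qed.

Section Trace.
Variables (R : realFieldType) (n : nat).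
Implicit Types A B D M : 'M[R]_n.

Lemma mxtrMC A B : \tr (A * B) = \tr (B * A).
Proof. exact: mxtrace_mulC. Qed.

Lemma scaleMl (a : R) A B : a *: (A * B) = (a *: A) * B.
Proof. exact: scalemxAl. Qed.

Lemma scaleMr (a : R) A B : a *: (A * B) = A * (a *: B).
Proof. exact: scalemxAr. Qed.

Lemma mxtraceB A B : \tr (A - B) = \tr A - \tr B.
Proof. exact: raddfB. Qed.

Lemma trmxM A B : (A * B)^T = B^T * A^T.
Proof. exact: trmx_mul. Qed.

Lemma trmxX A k : (A ^+ k)^T = A^T ^+ k.
Proof. by elim: k => [|k IH]; rewrite ?trmx1// exprS trmxM IH -exprSr. Qed.

Lemma mxtr_frob_ge0 A : 0 <= \tr (A^T * A).
Proof.
apply: sumr_ge0 => i _; rewrite !mxE; apply: sumr_ge0 => j _.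
by rewrite mxE -expr2 sqr_ge0.
Qed.

Lemma mxtr_frob_young A B :
  2 * \tr (A^T * B) <= \tr (A^T * A) + \tr (B^T * B).
Proof.
have := mxtr_frob_ge0 (A - B).
have -> : \tr (B^T * B) = \tr (B * B^T) by rewrite mxtrMC.
rewrite !raddfB /= mulrBr !mulrBl !raddfB /=.
have -> : \tr (B^T * A) = \tr (A^T * B).
  by rewrite -mxtrace_tr trmxM trmxK.
rewrite (mxtrMC B^T); lra.
Qed.

Lemma mxtr_frob_young_sym A B : A^T = A -> B^T = B ->
  2 * \tr (A * B) <= \tr (A * A) + \tr (B * B).
Proof. by move=> sA sB; have := mxtr_frob_young A B; rewrite sA sB. Qed.

(** Telescoping with the order of the factors kept, since [A] and [B] need not commute. *)
Lemma expr_subE A B N :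
  A ^+ N.+1 - B ^+ N.+1 = \sum_(k < N.+1) A ^+ k * (A - B) * B ^+ (N - k).
Proof.
elim: N => [|N IH].
  by rewrite big_ord1 expr0 mul1r mulr1.
rewrite big_ord_recr /= subnn mulr1.
have -> : \sum_(i < N.+1) A ^+ i * (A - B) * B ^+ (N.+1 - i) =
          (A ^+ N.+1 - B ^+ N.+1) * B.
  rewrite IH mulr_suml; apply: eq_bigr => i _.
  have iN : (i <= N)%N by rewrite -ltnS.
  by rewrite (subSn iN) exprSr mulrA.
by rewrite mulrBl mulrBr -!exprSr [RHS]addrC addrA subrK.
Qed.

(* The maps [k |-> tr (D A^k D B^(2q-k))] satisfy a discrete convexity:
   Cauchy-Schwarz for the Frobenius product compares an odd index with its
   neighbours, and an even index with the neighbouring even ones. *)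
Lemma mxtr_pow_sub_le A B q : A^T = A -> B^T = B ->
  \tr ((A - B) * (A ^+ q.*2.+1 - B ^+ q.*2.+1)) <=
  q.*2.+1%:R / 2 * \tr ((A - B) * (A - B) * (A ^+ q.*2 + B ^+ q.*2)).
Proof.
move=> sA sB; set D := A - B.
have sD : D^T = D by rewrite raddfB /= sA sB.
have sAk k : (A ^+ k)^T = A ^+ k by rewrite trmxX sA.
have sBk k : (B ^+ k)^T = B ^+ k by rewrite trmxX sB.
pose g k l := \tr (D * A ^+ k * D * B ^+ l).
(* Young's inequality for [A^a D B^b] and [A^a' D B^b']; cyclicity of the trace merges the outer
   powers of [B]. *)
have young a b a' b' :
    2 * g (a + a')%N (b' + b)%N <= g (a + a)%N (b + b)%N + g (a' + a')%N (b' + b')%N.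
  have := mxtr_frob_young (A ^+ a * D * B ^+ b) (A ^+ a' * D * B ^+ b').
  rewrite !trmxM !sAk !sBk sD -!mulrA.
  rewrite !(mxtrMC (B ^+ _)) -!mulrA -!exprD.
  have E k l m : \tr (D * (A ^+ k * (A ^+ l * (D * B ^+ m)))) = g (k + l)%N m.
    by rewrite /g (exprD A) !mulrA.
  by rewrite !E.
have godd i j : 2 * g i.*2.+1 j.*2.+1 <= g i.*2 j.*2.+2 + g i.*2.+2 j.*2.
  by have := young i j.+1 i.+1 j; rewrite !(addSn, addnS) !addnn.
have geven i j : 2 * g i.+1.*2 j.+1.*2 <= g i.*2 j.+2.*2 + g i.+2.*2 j.*2.
  by have := young i j.+2 i.+2 j; rewrite !(addSn, addnS) !addnn.
(* [c] collects the two extreme terms. Symmetrizing in the exponents and subtracting [c] makes [f]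
   vanish at both ends, while [geven] makes it convex. *)
pose c := g 0%N q.*2 + g q.*2 0%N.
pose f i := g i.*2 (q - i).*2 + g (q - i).*2 i.*2 - c.
have f_le0 i : (i <= q)%N -> f i <= 0.
  apply: le0_of_discrete_convex.
  - by rewrite /f subn0 subrr.
  - by rewrite /f subnn double0 addrC addrC [g _ 0%N + _]addrC subrr.
  - move=> {}i iq; rewrite /f.
    have := geven i (q - i.+2)%N; have := geven (q - i.+2)%N i.
    rewrite -!subSn ?subSS//; last by apply: ltnW.
    lra.
have sumg : \sum_(k < q.*2.+1) g k (q.*2 - k)%N <= q.*2.+1%:R / 2 * c.
  (* Averaging the sum with its reversal leaves terms [g k l + g l k], each at most [c]: for even
     [k] by [f_le0], for odd [k] by [godd] and the two even neighbours. *)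
  have -> : \sum_(k < q.*2.+1) g k (q.*2 - k)%N =
     2^-1 * \sum_(k < q.*2.+1) (g k (q.*2 - k)%N + g (q.*2 - k)%N k).
    rewrite big_split /= [X in _ + X](reindex_inj rev_ord_inj) /=.
    have -> : \sum_(j < q.*2.+1) g (q.*2 - (q.*2.+1 - j.+1))%N (q.*2.+1 - j.+1)%N
       = \sum_(k < q.*2.+1) g k (q.*2 - k)%N.
      by apply: eq_bigr => j _; rewrite subSS subKn// -ltnS.
    lra.
  rewrite [_ / 2]mulrC -mulrA ler_pM2l ?invr_gt0//.
  have -> : q.*2.+1%:R * c = \sum_(k < q.*2.+1) c.
    by rewrite sumr_const card_ord mulr_natl.
  apply: ler_sum => -[k /= klt] _; rewrite ltnS in klt.
  have ek : k = (odd k + k./2.*2)%N by rewrite odd_double_half.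
  case: (odd k) ek => ek; rewrite ek in klt *; rewrite ?add0n ?add1n in klt *.
    have kq : (k./2 < q)%N by rewrite -ltn_double.
    have := godd k./2 (q - k./2.+1)%N; have := godd (q - k./2.+1)%N k./2.
    have /= := f_le0 _ kq; have /= := f_le0 _ (ltnW kq); rewrite /f.
    have -> : (q.*2 - k./2.*2.+1)%N = (q - k./2.+1).*2.+1.
      by rewrite doubleB doubleS -subSn ?subSS // -doubleS leq_double.
    have -> : (q - k./2)%N = (q - k./2.+1).+1 by rewrite -subSn// subSS.
    rewrite !doubleS; lra.
  have kq : (k./2 <= q)%N by rewrite -leq_double.
  by have := f_le0 _ kq; rewrite /f -doubleB; lra.
rewrite expr_subE -/D mulr_sumr raddf_sum /=.
have -> : \tr (D * D * (A ^+ q.*2 + B ^+ q.*2)) = c.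
  rewrite /c /g expr0 !mulr1 mulrDr raddfD /= addrC; congr (_ + _).
  by rewrite [RHS]mxtrMC mulrA.
by under eq_bigr => k _ do rewrite !mulrA.
Qed.

Lemma quadE A v : quad A v = \sum_j \sum_k v j 0 * A j k * v k 0.
Proof.
rewrite /quad mxE exchange_big /=; apply: eq_bigr => k _.
by rewrite mxE mulr_suml; apply: eq_bigr => j _; rewrite mxE.
Qed.

Lemma quadD A B v : quad (A + B) v = quad A v + quad B v.
Proof. by rewrite /quad mulmxDr mulmxDl mxE. Qed.

Lemma quadN A v : quad (- A) v = - quad A v.
Proof. by rewrite /quad mulmxN mulNmx mxE. Qed.

Lemma quadB A B v : quad (A - B) v = quad A v - quad B v.
Proof. by rewrite quadD quadN. Qed.

Lemma quadZ a A v : quad (a *: A) v = a * quad A v.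
Proof. by rewrite /quad -scalemxAr -scalemxAl mxE. Qed.

Lemma mxtr_quad M B : \tr (B^T * (M * B)) = \sum_i quad M (col i B).
Proof.
apply: eq_bigr => i _; rewrite /quad -mulmxA [LHS]mxE [RHS]mxE.
apply: eq_bigr => j _; rewrite !mxE; congr (_ * _).
by apply: eq_bigr => k _; rewrite !mxE.
Qed.

(** Splitting the even power and cycling one half gives [tr (A^k M A^k)], a sum of values of the
    form of [M] at the columns of [A^k]. *)
Lemma mxtr_psd_ge0 M A k : A^T = A -> psd M -> 0 <= \tr (M * A ^+ k.*2).
Proof.
move=> sA pM; rewrite -addnn exprD mulrA mxtrMC.
rewrite -{1}sA -trmxX mxtr_quad; apply: sumr_ge0 => i _; exact: pM.
Qed.

Lemma mxtr_psd_le (M N A : 'M[R]_n) k : A^T = A -> psd (N - M) ->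
  \tr (M * A ^+ k.*2) <= \tr (N * A ^+ k.*2).
Proof. by move=> sA /(mxtr_psd_ge0 k sA); rewrite mulrBl raddfB subr_ge0. Qed.

(** Young's inequality for [A^(k+1)] and [a A^k], divided by [a]. It trades an odd power, whose
    trace has no definite sign, for two even ones. *)
Lemma mxtr_pow_odd_le (a : R) A k : A^T = A -> 0 < a ->
  2 * \tr (A ^+ k.*2.+1) <= a^-1 * \tr (A ^+ k.*2.+2) + a * \tr (A ^+ k.*2).
Proof.
move=> sA a0.
have := @mxtr_frob_young_sym (A ^+ k.+1) (a *: A ^+ k).
rewrite linearZ /= !trmxX sA => /(_ erefl erefl).
rewrite -scaleMr -scaleMl -scaleMr !linearZ /= -!exprD addSn addnS addSn addnn.
move=> H; rewrite -(ler_pM2l a0) mulrDr mulVKf ?gt_eqF//; lra.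
Qed.

End Trace.

Definition rank1_dev (R : realFieldType) (n : nat) (S : 'M[R]_n) (x : 'cV[R]_n) :
  'M[R]_n := x *m x^T - S.

Section GhostPair.
Variables (R : realFieldType) (n : nat).
Implicit Types (x y : 'cV[R]_n) (A S : 'M[R]_n).

Lemma dot_sum_sqr x : (x^T *m x) 0 0 = \sum_i x i 0 ^+ 2.
Proof. by rewrite mxE; apply: eq_bigr => i _; rewrite mxE expr2. Qed.

Lemma quad_sqr A v : A^T = A -> quad (A * A) v = \sum_i (A *m v) i 0 ^+ 2.
Proof.
by move=> sA; rewrite -dot_sum_sqr trmx_mul sA /quad -!mulmxA.
Qed.

Lemma quad_rank1 x v : quad (x *m x^T) v = (x^T *m v) 0 0 ^+ 2.
Proof.
rewrite /quad !mulmxA -mulmxA mxE big_ord1 expr2; congr (_ * _).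
by rewrite !mxE; apply: eq_bigr => i _; rewrite !mxE mulrC.
Qed.

(** The difference sends [v] to [(x.v) x - (y.v) y], and [|a - b|^2 <= 2 |a|^2 + 2 |b|^2] leaves
    [2 |x|^2 (x.v)^2 + 2 |y|^2 (y.v)^2]. *)
Lemma psd_rank1_sub_sqr L x y :
  (x^T *m x) 0 0 <= L -> (y^T *m y) 0 0 <= L ->
  psd ((2 * L) *: (x *m x^T + y *m y^T)
       - (x *m x^T - y *m y^T) * (x *m x^T - y *m y^T)).
Proof.
move=> xL yL v; rewrite quadB quadZ quadD !quad_rank1 subr_ge0.
set D := x *m x^T - y *m y^T.
have sD : D^T = D by rewrite raddfB /= !trmx_mul !trmxK.
rewrite quad_sqr// mulrDr.
have sq0 (z : 'cV[R]_n) : 0 <= (z^T *m v) 0 0 ^+ 2 by exact: sqr_ge0.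
have h1 := ler_wpM2r (sq0 x) xL; have h2 := ler_wpM2r (sq0 y) yL.
apply: (@le_trans _ _ (2 * ((x^T *m x) 0 0 * (x^T *m v) 0 0 ^+ 2)
   + 2 * ((y^T *m y) 0 0 * (y^T *m v) 0 0 ^+ 2))); last by lra.
rewrite !dot_sum_sqr !mulr_suml !mulr_sumr -big_split /=.
apply: ler_sum => i _.
have -> : (D *m v) i 0 = x i 0 * (x^T *m v) 0 0 - y i 0 * (y^T *m v) 0 0.
  have rk (z : 'cV[R]_n) : (z *m z^T *m v) i 0 = z i 0 * (z^T *m v) 0 0.
    by rewrite -mulmxA mxE big_ord1.
  by rewrite /D mulmxBl mxE rk [X in _ + X]mxE rk.
have := sqr_ge0 (x i 0 * (x^T *m v) 0 0 + y i 0 * (y^T *m v) 0 0).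
by rewrite !expr2; lra.
Qed.

(** Both [A] and [S] cancel in the difference of the two bases, which is [x x^T - y y^T]. After
    [mxtr_pow_sub_le] its square is replaced by the bound of [psd_rank1_sub_sqr], tested against
    even powers. *)
Lemma ghost_pair_le L x y A S q : A^T = A -> S^T = S ->
  (x^T *m x) 0 0 <= L -> (y^T *m y) 0 0 <= L ->
  \tr ((rank1_dev S x - rank1_dev S y) *
       ((A + rank1_dev S x) ^+ q.*2.+1 - (A + rank1_dev S y) ^+ q.*2.+1)) <=
  q.*2.+1%:R * L * \tr ((x *m x^T + y *m y^T) *
                  ((A + rank1_dev S x) ^+ q.*2 + (A + rank1_dev S y) ^+ q.*2)).
Proof.
move=> sA sS xL yL; set Y := rank1_dev S.
have sY z : (Y z)^T = Y z by rewrite raddfB /= trmx_mul trmxK sS.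
have sAY z : (A + Y z)^T = A + Y z by rewrite raddfD /= sA sY.
have DE : A + Y x - (A + Y y) = Y x - Y y by rewrite opprD addrACA subrr add0r.
have := mxtr_pow_sub_le q (sAY x) (sAY y); rewrite DE => /le_trans; apply.
have -> : Y x - Y y = x *m x^T - y *m y^T.
  by rewrite /Y /rank1_dev opprB addrA subrK.
have P := psd_rank1_sub_sqr xL yL.
have N0 : 0 <= q.*2.+1%:R / 2 :> R by rewrite divr_ge0.
have -> : q.*2.+1%:R * L = q.*2.+1%:R / 2 * (2 * L) by field.
rewrite -[X in _ <= X]mulrA; apply: ler_wpM2l => //.
have := mxtr_psd_le q (sAY x) P; have := mxtr_psd_le q (sAY y) P.
rewrite -[X in _ -> _ -> _ <= X]linearZ /= scaleMl.
move: (x *m x^T - _) (_ *: _) => D G hy hx.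
by rewrite !mulrDr !mxtraceD lerD.
Qed.

End GhostPair.

(** * Quadratic forms, operator norm and extreme eigenvalues *)

Section CauchySchwarz.
Variables (R : realFieldType) (n : nat).
Implicit Types (x y v w : 'cV[R]_n) (A B P : 'M[R]_n).

Definition sqnorm m (v : 'cV[R]_m) : R := \sum_i v i 0 ^+ 2.

Lemma sqnorm_ge0 m (v : 'cV[R]_m) : 0 <= sqnorm v.
Proof. by apply: sumr_ge0 => i _; exact: sqr_ge0. Qed.

Lemma sqnormE m (v : 'cV[R]_m) : sqnorm v = (v^T *m v) 0 0.
Proof. by rewrite dot_sum_sqr. Qed.

Lemma sqnorm_eq0 m (v : 'cV[R]_m) : (sqnorm v == 0) = (v == 0).
Proof.
rewrite psumr_eq0 => [|i _]; last exact: sqr_ge0.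
apply/allP/eqP => [v0|-> i _] /=; last by rewrite mxE expr0n eqxx.
apply/colP => i; rewrite mxE; apply/eqP.
by rewrite -sqrf_eq0; apply: (v0 i); rewrite mem_index_enum.
Qed.

Lemma sqnorm_delta m (i : 'I_m) : sqnorm (delta_mx i 0) = 1.
Proof.
rewrite /sqnorm (bigD1 i)//= big1 ?addr0 => [|j /negPf ji].
  by rewrite mxE !eqxx expr1n.
by rewrite mxE ji expr0n.
Qed.

Lemma quad_scalar a v : quad a%:M v = a * sqnorm v.
Proof. by rewrite -scalemx1 quadZ /quad mulmx1 sqnormE. Qed.

Lemma psd_cauchy_schwarz A v w : A^T = A -> psd A ->
  (w^T *m A *m v) 0 0 ^+ 2 <= quad A v * quad A w.
Proof.
move=> sA pA; set c := (w^T *m A *m v) 0 0.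
have E a b : quad A (a *: v + b *: w) =
    a ^+ 2 * quad A v + 2 * a * b * c + b ^+ 2 * quad A w.
  have C : (v^T *m A *m w) 0 0 = c.
    have -> : v^T *m A *m w = (w^T *m A *m v)^T.
      by rewrite !trmx_mul trmxK sA mulmxA.
    by rewrite mxE.
  have tr : (a *: v + b *: w)^T = a *: v^T + b *: w^T.
    by apply/rowP => i; rewrite !mxE.
  rewrite /quad tr.
  rewrite !mulmxDr !mulmxDl -!scalemxAl -!scalemxAr.
  move: C; rewrite /c; move: (_ *m v) (w^T *m _ *m w) => B1 B2.
  move: (_ *m w) (_ *m v) => B3 B4 C; rewrite !mxE C; ring.
(* If [quad A v = 0], the form at [a v + w] is affine in [a]. Were [c] nonzero, the value of [a]
   chosen below would make it [-1]. *)
have [v0|v0] := eqVneq (quad A v) 0.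
  rewrite v0 mul0r; have H a : 0 <= 2 * a * c + quad A w.
    by have := pA (a *: v + 1 *: w); rewrite E v0 mulr0 add0r mulr1 expr1n mul1r.
  have [-> |c0] := eqVneq c 0; first by rewrite expr0n.
  have := H (- (quad A w + 1) / (2 * c)).
  have -> : 2 * (- (quad A w + 1) / (2 * c)) * c + quad A w = -1.
    by field.
  by rewrite lerNr oppr0 ler10.
have vp : 0 < quad A v by rewrite lt_neqAle eq_sym v0 pA.
(* At this combination the form is [quad A v] times the difference of the two sides of the claim. *)
have := pA (c *: v + (- quad A v) *: w); rewrite E.
have -> : c ^+ 2 * quad A v + 2 * c * - quad A v * c + (- quad A v) ^+ 2 * quad A w
  = quad A v * (quad A v * quad A w - c ^+ 2) by ring.
by rewrite pmulr_rge0// subr_ge0.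
Qed.

Lemma dot_cauchy_schwarz v w : (w^T *m v) 0 0 ^+ 2 <= sqnorm v * sqnorm w.
Proof.
have p1 : psd (1%:M : 'M[R]_n).
  by move=> x; rewrite quad_scalar mul1r sqnorm_ge0.
have := psd_cauchy_schwarz v w (trmx1 _ _) p1.
by rewrite mulmx1 !quad_scalar !mul1r.
Qed.

(** Cauchy-Schwarz for the form of [A] with [w = A v] gives [|A v|^4 <= quad A v * quad A (A v) <=
    quad A v * c |A v|^2]; divide by [|A v|^2]. *)
Lemma psd_sqr_le c A v : A^T = A -> psd A -> psd (c%:M - A) ->
  sqnorm (A *m v) <= c * quad A v.
Proof.
move=> sA pA pcA.
have := psd_cauchy_schwarz v (A *m v) sA pA.
have -> : ((A *m v)^T *m A *m v) 0 0 = sqnorm (A *m v).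
  by rewrite sqnormE -mulmxA.
have := pcA (A *m v); rewrite quadB quad_scalar subr_ge0 => H1 H2.
have := pA v; have := sqnorm_ge0 (A *m v).
rewrite le_eqVlt => /orP[/eqP <- qv|p qv].
  (* Here [|A v| = 0], so division is impossible and the sign of [c * quad A v] is what remains: a
     nonzero [v] forces [0 <= c]. *)
  have c0 : 0 <= c \/ quad A v = 0.
    have [->|vn0] := eqVneq v 0.
      by right; rewrite /quad mulmx0 mxE.
    left; have := pcA v; rewrite quadB quad_scalar subr_ge0 => /(le_trans qv).
    by rewrite pmulr_lge0// lt_neqAle eq_sym sqnorm_eq0 vn0 sqnorm_ge0.
  by case: c0 => [c0|->]; rewrite ?mulr0// mulr_ge0.
rewrite -(ler_pM2r p) -expr2; apply: le_trans H2 _.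
by rewrite [c * _]mulrC -mulrA; apply: ler_wpM2l.
Qed.

End CauchySchwarz.

Section Frobenius.
Variables (R : realFieldType).

Definition frob m n (A : 'M[R]_(m, n)) : R := \sum_i \sum_j A i j ^+ 2.

Lemma frob_ge0 m n (A : 'M[R]_(m, n)) : 0 <= frob A.
Proof. by do 2!apply: sumr_ge0 => ? _; exact: sqr_ge0. Qed.

Lemma sqnorm_mul_le m n (A : 'M[R]_(m, n)) v :
  sqnorm (A *m v) <= frob A * sqnorm v.
Proof.
rewrite mulr_suml; apply: ler_sum => i _.
have := dot_cauchy_schwarz v (row i A)^T; rewrite trmxK.
have -> : (row i A *m v) 0 0 = (A *m v) i 0 by rewrite -row_mul mxE.
move=> /le_trans; apply; rewrite mulrC.
rewrite ler_wpM2r ?sqnorm_ge0// /sqnorm; apply: ler_sum => j _.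
by rewrite !mxE.
Qed.

Lemma frob_mxtr n (A : 'M[R]_n) : frob A = \tr (A^T * A).
Proof.
rewrite /frob exchange_big /=; apply: eq_bigr => j _; rewrite mxE.
by apply: eq_bigr => i _; rewrite mxE expr2.
Qed.

Variable n : nat.
Implicit Types (A B : 'M[R]_n).

(** The constant [frob A + 1] replaces the square root of [frob A], since [f <= (f + 1)^2] for
    [f >= 0]; a finite bound is all that is asked of it. *)
Lemma quad_ler (A : 'M[R]_n) v : `|quad A v| <= (frob A + 1) * sqnorm v.
Proof.
have := dot_cauchy_schwarz (A *m v) v; rewrite mulmxA -/(quad A v).
have := sqnorm_mul_le A v; have := sqnorm_ge0 v; have := frob_ge0 A.
move: (quad A v) (sqnorm v) (frob A) (sqnorm (A *m v)) => q s f t f0 s0 tfs qts.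
rewrite -ler_sqr ?nnegrE ?mulr_ge0 ?addr_ge0// real_normK ?num_real//.
apply: le_trans qts _; apply: le_trans (ler_wpM2r s0 tfs) _.
have := mulr_ge0 s0 s0; have := mulr_ge0 f0 f0.
rewrite !expr2; nra.
Qed.

Lemma psd_scalar_sub a A : psd (a%:M - A) <-> forall v, quad A v <= a * sqnorm v.
Proof.
by split => H v; have := H v; rewrite quadB quad_scalar subr_ge0.
Qed.

Lemma psd_sub_scalar a A : psd (A - a%:M) <-> forall v, a * sqnorm v <= quad A v.
Proof.
by split => H v; have := H v; rewrite quadB quad_scalar subr_ge0.
Qed.

(* With [s_k = |A^k v|^2], Cauchy-Schwarz gives [s_k^2 <= s_(k-1) s_(k+1)], so
   a ratio [s_1 / s_0 > t^2] propagates to all later ratios. *)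
Lemma lt_sqnorm_mxtr_pow A v t p : A^T = A -> 0 <= t ->
  t ^+ 2 * sqnorm v < sqnorm (A *m v) -> t ^+ p.*2 <= \tr (A ^+ p.*2).
Proof.
move=> sA t0 lt.
have vp : 0 < sqnorm v.
  rewrite lt_neqAle sqnorm_ge0 andbT eq_sym; apply/eqP => v0.
  move: lt; move/eqP: v0; rewrite sqnorm_eq0 => /eqP ->.
  have /eqP z : sqnorm (0 : 'cV[R]_n) == 0 by rewrite sqnorm_eq0.
  by rewrite mulmx0 z mulr0 ltxx.
pose s k := sqnorm (A ^+ k *m v).
have s0 k : 0 <= s k by exact: sqnorm_ge0.
have dot_pow a b : ((A ^+ a *m v)^T *m (A ^+ b *m v)) 0 0 = quad (A ^+ (a + b)) v.
  by rewrite /quad exprD trmx_mul trmxX sA -mulmxE !mulmxA.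
have cs k : s k.+1 ^+ 2 <= s k * s k.+2.
  have := dot_cauchy_schwarz (A ^+ k *m v) (A ^+ k.+2 *m v).
  have -> : ((A ^+ k.+2 *m v)^T *m (A ^+ k *m v)) 0 0 = s k.+1.
    by rewrite /s sqnormE !dot_pow addSnnS.
  by [].
have step k : 0 < s k /\ t ^+ 2 * s k < s k.+1.
  elim: k => [|k [IH1 IH2]]; first by rewrite /s expr0 mul1mx expr1.
  have h : 0 < s k.+1 by apply: le_lt_trans IH2; rewrite mulr_ge0// sqr_ge0.
  split=> //; rewrite -(ltr_pM2l IH1); apply: lt_le_trans (cs k).
  by rewrite mulrCA mulrA expr2 ltr_pM2r.
have sp k : (t ^+ 2) ^+ k * s 0%N <= s k.
  elim: k => [|k IH]; first by rewrite expr0 mul1r.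
  rewrite exprS -mulrA; apply: le_trans (ltW (step k).2).
  by rewrite ler_wpM2l// sqr_ge0.
(* [t^(2p) |v|^2 <= |A^p v|^2 <= frob (A^p) |v|^2], and [frob (A^p)] is the trace of [A^(2p)] by
   symmetry. *)
have := le_trans (sp p) (sqnorm_mul_le _ _).
rewrite /s expr0 mul1mx ler_pM2r// frob_mxtr trmxX sA -exprD addnn.
by rewrite -exprM mul2n.
Qed.

End Frobenius.

Section Eigenvalues.
Variables (R : realType) (n : nat).
Implicit Types (A B : 'M[R]_n.+1).

Lemma eigenvalue_quad A a : eigenvalue A a ->
  exists2 v, 0 < sqnorm v & quad A v = a * sqnorm v.
Proof.
move=> /eigenvalueP[v vA v0]; exists v^T.
  by rewrite lt_neqAle eq_sym sqnorm_eq0 trmx_eq0 v0 sqnorm_ge0.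
by rewrite /quad trmxK vA -scalemxAl mxE sqnormE trmxK.
Qed.

(* At the largest [a] with [A - a I] positive semidefinite, [A - a I] is
   singular: an invertible positive semidefinite matrix dominates [e I]. *)
Lemma min_eigenvalue A : A^T = A -> exists2 a, eigenvalue A a & psd (A - a%:M).
Proof.
move=> sA; pose E := [set a : R | psd (A - a%:M)].
have E0 : E !=set0.
  exists (- (frob A + 1)); apply/psd_sub_scalar => v.
  by have := quad_ler A v; rewrite ler_norml mulNr => /andP[].
have Eub : ubound E (quad A (delta_mx 0 0)).
  by move=> a /psd_sub_scalar /(_ (delta_mx 0 0)); rewrite sqnorm_delta mulr1.
have hs : has_sup E by split => //; exists (quad A (delta_mx 0 0)).
pose a := sup E.
have pa : psd (A - a%:M).
  apply/psd_sub_scalar => v.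
  have := sqnorm_ge0 v; rewrite le_eqVlt => /orP[/eqP v0|v0].
    by have := quad_ler A v; rewrite -v0 !mulr0 normr_le0 => /eqP ->.
  rewrite -ler_pdivlMr//; apply: ge_sup => // b /psd_sub_scalar /(_ v).
  by rewrite ler_pdivlMr.
exists a => //; rewrite /eigenvalue /eigenspace kermx_eq0 row_free_unit.
set B := A - a%:M; apply/negP => uB.
have sB : B^T = B by rewrite raddfB /= sA tr_scalar_mx.
pose c := frob B + 1; pose k := frob (invmx B) + 1.
have c0 : 0 < c by rewrite ltr_wpDl ?frob_ge0.
have k0 : 0 < k by rewrite ltr_wpDl ?frob_ge0.
have pcB : psd (c%:M - B).
  apply/psd_scalar_sub => v.
  by apply: le_trans (quad_ler B v); rewrite ler_norm.
(* [|v|^2 <= k |B v|^2 <= k c quad B v]: the first bound uses the inverse of [B], the second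
   [psd_sqr_le]. Hence [a] could be raised, against its being the supremum. *)
have : E (a + (k * c)^-1).
  apply/psd_sub_scalar => v; rewrite mulrDl -lerBrDl.
  have -> : quad A v - a * sqnorm v = quad B v by rewrite quadB quad_scalar.
  rewrite ler_pdivrMl ?mulr_gt0// -mulrA.
  apply: le_trans (ler_wpM2l (ltW k0) (psd_sqr_le v sB pa pcB)).
  have := sqnorm_mul_le (invmx B) (B *m v); rewrite mulKmx// => /le_trans; apply.
  by rewrite ler_wpM2r ?sqnorm_ge0// lerDl.
move=> /(ub_le_sup hs.2); rewrite -/a gerDl leNgt invr_gt0 mulr_gt0//.
Qed.

Lemma max_eigenvalue A : A^T = A -> exists2 a, eigenvalue A a & psd (a%:M - A).
Proof.
move=> sA; have [|a ea pa] := @min_eigenvalue (- A); first by rewrite raddfN /= sA.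
exists (- a); last first.
  by move=> v; have := pa v; rewrite !quadB !quadN !quad_scalar; lra.
move/eigenvalueP: ea => [v vA v0]; apply/eigenvalueP; exists v => //.
by rewrite scaleNr -vA mulmxN opprK.
Qed.

(** [min_eigenvalue] supplies an eigenvalue that bounds the form below, so the infimum is over a
    nonempty set bounded below and is not a default value. *)
Lemma le_lambda_min A a : A^T = A -> a <= lambda_min A <-> psd (A - a%:M).
Proof.
move=> sA; have [b eb pb] := min_eigenvalue sA.
have lbE c : psd (A - c%:M) -> lbound [set a : R | eigenvalue A a] c.
  move=> /psd_sub_scalar pc d /= /eigenvalue_quad[v v0 qv].
  by have := pc v; rewrite qv ler_pM2r.
split=> [le|pa]; last first.
  by apply: lb_le_inf; [exists b|exact: lbE].
have ab : a <= b.
  by apply: le_trans le _; apply: ge_inf => //; exists b; exact: lbE.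
apply/psd_sub_scalar => v; move/psd_sub_scalar: pb => /(_ v).
by apply: le_trans; rewrite ler_wpM2r// sqnorm_ge0.
Qed.

Lemma lambda_max_le A a : A^T = A -> lambda_max A <= a <-> psd (a%:M - A).
Proof.
move=> sA; have [b eb pb] := max_eigenvalue sA.
have ubE c : psd (c%:M - A) -> ubound [set a : R | eigenvalue A a] c.
  move=> /psd_scalar_sub pc d /= /eigenvalue_quad[v v0 qv].
  by have := pc v; rewrite qv ler_pM2r.
split=> [le|pa]; last first.
  by apply: ge_sup; [exists b|exact: ubE].
have ab : b <= a.
  by apply: le_trans le; apply: ub_le_sup => //; exists b; exact: ubE.
apply/psd_scalar_sub => v; move/psd_scalar_sub: pb => /(_ v).
by move/le_trans; apply; rewrite ler_wpM2r// sqnorm_ge0.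
Qed.

Lemma lambda_min_le_max A : A^T = A -> lambda_min A <= lambda_max A.
Proof.
move=> sA; have [b eb _] := min_eigenvalue sA.
apply: (@le_trans _ _ b).
  have := lexx (lambda_min A); rewrite {2}/lambda_min.
  move=> /(le_lambda_min _ sA) /psd_sub_scalar p.
  by have [v v0 qv] := eigenvalue_quad eb; have := p v; rewrite qv ler_pM2r.
have := lexx (lambda_max A); move=> /(lambda_max_le _ sA) /psd_scalar_sub p.
by have [v v0 qv] := eigenvalue_quad eb; have := p v; rewrite qv ler_pM2r.
Qed.

End Eigenvalues.

Section OperatorNorm.
Variables (R : realType) (n : nat).
Implicit Types (A B : 'M[R]_n).

Lemma vnorm_ge0 m (v : 'cV[R]_m) : 0 <= vnorm v.
Proof. exact: sqrtr_ge0. Qed.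

Lemma sqr_vnorm m (v : 'cV[R]_m) : vnorm v ^+ 2 = sqnorm v.
Proof. by rewrite sqr_sqrtr// sqnorm_ge0. Qed.

Lemma vnorm_scale m a (v : 'cV[R]_m) : vnorm (a *: v) = `|a| * vnorm v.
Proof.
apply/eqP; rewrite -(@eqrXn2 _ 2) ?mulr_ge0 ?vnorm_ge0//.
rewrite exprMn !sqr_vnorm real_normK ?num_real//; apply/eqP.
by rewrite /sqnorm mulr_sumr; apply: eq_bigr => i _; rewrite mxE exprMn.
Qed.

Lemma opnorm_set_has_sup m (A : 'M[R]_(m, n)) :
  has_sup [set vnorm (A *m v) | v in [set v : 'cV[R]_n | vnorm v <= 1]].
Proof.
split.
  exists (vnorm (A *m (0 : 'cV[R]_n))); exists 0 => //=.
  by rewrite -(scale0r 0) vnorm_scale normr0 mul0r.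
exists (frob A + 1) => _ [v /= v1 <-].
rewrite -ler_sqr ?nnegrE ?vnorm_ge0 ?addr_ge0 ?frob_ge0// sqr_vnorm.
apply: le_trans (sqnorm_mul_le _ _) _; rewrite -sqr_vnorm.
have v2 : vnorm v ^+ 2 <= 1 by rewrite expr_le1// vnorm_ge0.
have := ler_wpM2l (frob_ge0 A) v2; have := frob_ge0 A; nra.
Qed.

Lemma vnorm_mul_le m (A : 'M[R]_(m, n)) v : vnorm (A *m v) <= opnorm A * vnorm v.
Proof.
have := vnorm_ge0 v; rewrite le_eqVlt => /orP[/eqP v0|v0].
  have : sqnorm v == 0 by rewrite -sqr_vnorm -v0 expr0n.
  rewrite sqnorm_eq0 => /eqP v00; rewrite -v0 mulr0 v00 mulmx0.
  by rewrite -(scale0r 0) vnorm_scale normr0 mul0r.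
rewrite -ler_pdivrMr//.
apply: (ub_le_sup (opnorm_set_has_sup A).2).
exists ((vnorm v)^-1 *: v) => /=.
  by rewrite vnorm_scale ger0_norm ?invr_ge0 ?vnorm_ge0// mulVf ?gt_eqF.
by rewrite -scalemxAr vnorm_scale ger0_norm ?invr_ge0 ?vnorm_ge0// mulrC.
Qed.

Lemma opnorm_ge0 m (A : 'M[R]_(m, n)) : 0 <= opnorm A.
Proof.
apply: (@le_trans _ _ (vnorm (A *m (0 : 'cV[R]_n)))); first exact: vnorm_ge0.
apply: (ub_le_sup (opnorm_set_has_sup A).2); exists 0 => //=.
by rewrite -(scale0r 0) vnorm_scale normr0 mul0r.
Qed.

Lemma opnorm_leP m (A : 'M[R]_(m, n)) t : 0 <= t ->
  opnorm A <= t <-> forall v, sqnorm (A *m v) <= t ^+ 2 * sqnorm v.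
Proof.
move=> t0; split=> [le v|H].
  rewrite -!sqr_vnorm -exprMn ler_sqr ?nnegrE ?mulr_ge0 ?vnorm_ge0//.
  apply: le_trans (vnorm_mul_le _ _) _.
  by rewrite ler_wpM2r ?vnorm_ge0.
apply: ge_sup; first exact: (opnorm_set_has_sup A).1.
move=> _ [v /= v1 <-].
rewrite -ler_sqr ?nnegrE ?vnorm_ge0// sqr_vnorm.
apply: le_trans (H v) _; rewrite -sqr_vnorm ler_piMr ?sqr_ge0//.
by rewrite expr_le1 ?vnorm_ge0.
Qed.

(** This turns norm balls into semidefiniteness conditions, for which measurability is proved. *)
Lemma opnorm_le_psd m (A : 'M[R]_(m, n)) t : 0 <= t ->
  opnorm A <= t <-> psd ((t ^+ 2)%:M - A^T *m A).
Proof.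
move=> t0; rewrite opnorm_leP// psd_scalar_sub.
have E v : quad (A^T *m A) v = sqnorm (A *m v).
  by rewrite sqnormE trmx_mul /quad !mulmxA.
by split=> H v; have := H v; rewrite E.
Qed.

Lemma quad_le_opnorm A v : `|quad A v| <= opnorm A * sqnorm v.
Proof.
have o0 := opnorm_ge0 A; have s0 := sqnorm_ge0 v.
rewrite -ler_sqr ?nnegrE ?mulr_ge0// real_normK ?num_real//.
have := dot_cauchy_schwarz (A *m v) v; rewrite mulmxA -/(quad A v).
move=> /le_trans; apply; rewrite exprMn [X in _ <= _ * X]expr2 mulrA.
rewrite ler_wpM2r//.
by have /(opnorm_leP _ o0) := lexx (opnorm A); apply.
Qed.

Lemma psd_opnorm_le A c : A^T = A -> psd A -> 0 <= c -> psd (c%:M - A) ->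
  opnorm A <= c.
Proof.
move=> sA pA c0 pc; apply/opnorm_leP => // v.
apply: le_trans (psd_sqr_le v sA pA pc) _.
by rewrite expr2 -mulrA ler_wpM2l//; move/psd_scalar_sub: pc; apply.
Qed.

(** The strict inequality yields one vector stretched by more than [t], so no maximizer of the norm
    has to be found. *)
Lemma lt_opnorm_mxtr_pow A t p : A^T = A -> 0 <= t -> t < opnorm A ->
  t ^+ p.*2 <= \tr (A ^+ p.*2).
Proof.
move=> sA t0; rewrite ltNge => /negP nle.
have [v lt] : exists v, t ^+ 2 * sqnorm v < sqnorm (A *m v).
  apply/not_existsP => H; apply: nle; apply/opnorm_leP => // v.
  by rewrite leNgt; apply/negP/H.
exact: lt_sqnorm_mxtr_pow lt.
Qed.

End OperatorNorm.

(** * Expectations of bounded functions and independence *)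

(** The bound holds everywhere rather than almost everywhere: the class is then closed under sums,
    products and measurable substitution, and integrable for every probability. *)
Definition bmeas (R : realType) d (T : measurableType d) (f : T -> R) :=
  measurable_fun setT f /\ exists M, forall x, `|f x| <= M.

Definition bmeas_mx (R : realType) d (T : measurableType d) m n
    (F : T -> 'M[R]_(m, n)) :=
  forall i j, bmeas (fun x => F x i j).

Section BoundedMeasurable.
Context (R : realType) d (T : measurableType d).
Implicit Types (f g : T -> R).

Lemma bmeas_cst (c : R) : bmeas (fun _ : T => c).
Proof. by split; [exact: measurable_cst | exists `|c|]. Qed.

Lemma bmeasD f g : bmeas f -> bmeas g -> bmeas (fun x => f x + g x).
Proof.
move=> [mf [M fM]] [mg [N gN]]; split; first exact: measurable_funD.
by exists (M + N) => x; rewrite (le_trans (ler_normD _ _))// lerD.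
Qed.

Lemma bmeasM f g : bmeas f -> bmeas g -> bmeas (fun x => f x * g x).
Proof.
move=> [mf [M fM]] [mg [N gN]]; split; first exact: measurable_funM.
by exists (M * N) => x; rewrite normrM ler_pM.
Qed.

Lemma bmeasB f g : bmeas f -> bmeas g -> bmeas (fun x => f x - g x).
Proof.
move=> [mf [M fM]] [mg [N gN]]; split; first exact: measurable_funB.
by exists (M + N) => x; rewrite (le_trans (ler_normB _ _))// lerD.
Qed.

Lemma bmeas_sum (I : Type) (r : seq I) (p : pred I) (f : I -> T -> R) :
  (forall i, p i -> bmeas (f i)) -> bmeas (fun x => \sum_(i <- r | p i) f i x).
Proof.
move=> bf; elim: r => [|i r IH].
  by under eq_fun do rewrite big_nil; exact: bmeas_cst.
under eq_fun do rewrite big_cons.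
by case: (boolP (p i)) => pi; [apply: bmeasD => //; exact: bf | exact: IH].
Qed.

Lemma bmeas_comp d' (T' : measurableType d') f (h : T' -> T) :
  measurable_fun setT h -> bmeas f -> bmeas (fun x => f (h x)).
Proof.
move=> mh [mf [M fM]]; split; first exact: measurableT_comp.
by exists M => x; exact: fM.
Qed.

Lemma bmeas_mx_cst m n (A : 'M[R]_(m, n)) : bmeas_mx (fun _ : T => A).
Proof. by move=> i j; exact: bmeas_cst. Qed.

Lemma bmeas_mxD m n (F G : T -> 'M[R]_(m, n)) :
  bmeas_mx F -> bmeas_mx G -> bmeas_mx (fun x => F x + G x).
Proof. by move=> bF bG i j; under eq_fun do rewrite mxE; exact: bmeasD. Qed.

Lemma bmeas_mxB m n (F G : T -> 'M[R]_(m, n)) :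
  bmeas_mx F -> bmeas_mx G -> bmeas_mx (fun x => F x - G x).
Proof.
by move=> bF bG i j; under eq_fun do rewrite !mxE; exact: bmeasB.
Qed.

Lemma bmeas_mxM m n p (F : T -> 'M[R]_(m, n)) (G : T -> 'M[R]_(n, p)) :
  bmeas_mx F -> bmeas_mx G -> bmeas_mx (fun x => F x *m G x).
Proof.
move=> bF bG i j; under eq_fun do rewrite mxE.
by apply: bmeas_sum => k _; exact: bmeasM.
Qed.

Lemma bmeas_mx_tr m n (F : T -> 'M[R]_(m, n)) :
  bmeas_mx F -> bmeas_mx (fun x => (F x)^T).
Proof. by move=> bF i j; under eq_fun do rewrite mxE; exact: bF. Qed.

Lemma bmeas_mxX n (F : T -> 'M[R]_n) k :
  bmeas_mx F -> bmeas_mx (fun x => F x ^+ k).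
Proof.
move=> bF; elim: k => [|k IH]; first exact: bmeas_mx_cst.
by under eq_fun do rewrite exprS; exact: bmeas_mxM.
Qed.

Lemma bmeas_mx_sum m n (I : Type) (r : seq I) (p : pred I)
    (F : I -> T -> 'M[R]_(m, n)) :
  (forall i, p i -> bmeas_mx (F i)) ->
  bmeas_mx (fun x => \sum_(i <- r | p i) F i x).
Proof.
move=> bF i j; under eq_fun do rewrite summxE.
by apply: bmeas_sum => k pk; exact: bF.
Qed.

Lemma bmeas_mx_comp d' (T' : measurableType d') m n (F : T -> 'M[R]_(m, n))
    (h : T' -> T) :
  measurable_fun setT h -> bmeas_mx F -> bmeas_mx (fun x => F (h x)).
Proof. by move=> mh bF i j; exact: bmeas_comp (bF i j). Qed.

Lemma bmeas_tr n (F : T -> 'M[R]_n) : bmeas_mx F -> bmeas (fun x => \tr (F x)).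
Proof. by move=> bF; apply: bmeas_sum => i _; exact: bF. Qed.

End BoundedMeasurable.

Section Expectation.
Context (R : realType) d (T : measurableType d) (P : probability T R).
Implicit Types (f g : T -> R).

Lemma bmeas_integrable f : bmeas f -> P.-integrable setT (EFin \o f).
Proof.
move=> [mf [M fM]]; apply: measurable_bounded_integrable => //.
  by rewrite [X in (X < _)%E]probability_setT ltry.
exists M; split; first exact: num_real.
by move=> K MK x _; apply: le_trans (fM x) (ltW MK).
Qed.

Lemma EFin_Rintegral f : bmeas f ->
  (\int[P]_x (f x))%:E = (\int[P]_x (f x)%:E)%E.
Proof. by move=> bf; rewrite fineK// integrable_fin_num//; exact: bmeas_integrable. Qed.

Lemma expectD f g : bmeas f -> bmeas g ->
  \int[P]_x (f x + g x) = \int[P]_x f x + \int[P]_x g x.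
Proof. by move=> bf bg; rewrite RintegralD//; exact: bmeas_integrable. Qed.

Lemma expectB f g : bmeas f -> bmeas g ->
  \int[P]_x (f x - g x) = \int[P]_x f x - \int[P]_x g x.
Proof. by move=> bf bg; rewrite RintegralB//; exact: bmeas_integrable. Qed.

Lemma expectZ c f : bmeas f -> \int[P]_x (c * f x) = c * \int[P]_x f x.
Proof. by move=> bf; rewrite RintegralZl//; exact: bmeas_integrable. Qed.

Lemma expect_cst c : \int[P]_x c = c.
Proof. by rewrite Rintegral_cst//= probability_setT mulr1. Qed.

Lemma expect_le f g : bmeas f -> bmeas g -> (forall x, f x <= g x) ->
  \int[P]_x f x <= \int[P]_x g x.
Proof. by move=> bf bg le; apply: le_Rintegral => //; exact: bmeas_integrable. Qed.

Lemma expect_sum (I : Type) (r : seq I) (f : I -> T -> R) :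
  (forall i, bmeas (f i)) ->
  \int[P]_x (\sum_(i <- r) f i x) = \sum_(i <- r) \int[P]_x f i x.
Proof.
move=> bf; elim: r => [|i r IH].
  by rewrite big_nil; under eq_Rintegral do rewrite big_nil; exact: expect_cst.
rewrite big_cons -IH -expectD//; last by apply: bmeas_sum => j _; exact: bf.
by apply: eq_Rintegral => x _; rewrite big_cons.
Qed.

(** This and [expect_affineD] integrate out one point of the two-point inequality in
    [expect_dev_pow_le], in the very bracketing used there. *)
Lemma expect_affineB a f g h : bmeas f -> bmeas g -> bmeas h ->
  bmeas (fun x => a - f x + (g x - h x)) /\
  \int[P]_x (a - f x + (g x - h x)) =
  a - \int[P]_x f x + (\int[P]_x g x - \int[P]_x h x).
Proof.
move=> bf bg bh; have ba := bmeas_cst T a.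
have baf := bmeasB ba bf; have bgh := bmeasB bg bh.
by split; [exact: bmeasD|rewrite (expectD baf bgh) !expectB// expect_cst].
Qed.

Lemma expect_affineD c a f g h : bmeas f -> bmeas g -> bmeas h ->
  bmeas (fun x => c * (a + f x + (g x + h x))) /\
  \int[P]_x (c * (a + f x + (g x + h x))) =
  c * (a + \int[P]_x f x + (\int[P]_x g x + \int[P]_x h x)).
Proof.
move=> bf bg bh; have ba := bmeas_cst T a.
have baf := bmeasD ba bf; have bgh := bmeasD bg bh.
split; first by apply: (bmeasM (bmeas_cst T c)); exact: bmeasD.
by rewrite (expectZ _ (bmeasD baf bgh)) (expectD baf bgh) !expectD// expect_cst.
Qed.

Definition expect_mx m n (F : T -> 'M[R]_(m, n)) : 'M[R]_(m, n) :=
  \matrix_(i, j) \int[P]_x F x i j.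

Lemma expect_trM n (F G : T -> 'M[R]_n) : bmeas_mx F -> bmeas_mx G ->
  \int[P]_x \tr (F x * G x) = \sum_i \sum_j \int[P]_x (F x i j * G x j i).
Proof.
move=> bF bG; rewrite expect_sum => [|i]; last exact: (bmeas_mxM bF bG).
apply: eq_bigr => i _; rewrite -expect_sum => [|j]; last exact: bmeasM.
by apply: eq_Rintegral => x _; rewrite mxE.
Qed.

Lemma expect_trMl n (A : 'M[R]_n) (F : T -> 'M[R]_n) : bmeas_mx F ->
  \int[P]_x \tr (A * F x) = \tr (A * expect_mx F).
Proof.
move=> bF; rewrite (expect_trM (bmeas_mx_cst _ A) bF).
apply: eq_bigr => i _; rewrite mxE; apply: eq_bigr => j _.
by rewrite expectZ// mxE.
Qed.

Lemma expect_trMr n (A : 'M[R]_n) (F : T -> 'M[R]_n) : bmeas_mx F ->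
  \int[P]_x \tr (F x * A) = \tr (expect_mx F * A).
Proof.
move=> bF; rewrite mxtrMC -expect_trMl//.
by apply: eq_Rintegral => x _; rewrite mxtrMC.
Qed.

End Expectation.

Section Fubini.
Context (R : realType) d d1 d2 (Omega : measurableType d)
  (T1 : measurableType d1) (T2 : measurableType d2)
  (P : probability Omega R) (m1 : probability T1 R).

(** The joint law of [X] and [W] agrees with the product of [m1] and the law of [W] on rectangles,
    hence everywhere; Fubini's theorem then allows integrating over [X] first. *)
Lemma indep_expect (X : {RV P >-> T1}) (W : {RV P >-> T2}) (F : T1 * T2 -> R) :
  (forall A B, measurable A -> measurable B ->
     P (X @^-1` A `&` W @^-1` B) = (m1 A * P (W @^-1` B))%E) ->
  bmeas F ->
  bmeas (fun w => \int[m1]_x F (x, W w)) /\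
  \int[P]_w F (X w, W w) = \int[P]_w \int[m1]_x F (x, W w).
Proof.
move=> ind bF.
have bFy y : bmeas (fun x => F (x, y)).
  by apply: bmeas_comp bF; exact: measurable_pair2.
pose PW := distribution P W.
have iF : (m1 \x PW)%E.-integrable setT (EFin \o F) := bmeas_integrable _ bF.
have mXW : measurable_fun setT (fun w => (X w, W w)).
  by apply: measurable_fun_pair; exact: measurable_funPT.
pose XW : {mfun Omega >-> (T1 * T2)%type} :=
  HB.pack (fun w => (X w, W w)) (isMeasurableFun.Build _ _ _ _ _ mXW).
have mG : measurable_fun setT (fun y => (\int[m1]_x (F (x, y))%:E)%E).
  exact: (measurable_fubini_G iF).
have bG : bmeas (fun y => \int[m1]_x F (x, y)).
  split; last first.
    case: (bF) => _ [M FM]; exists M => y.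
    apply: le_trans (le_normr_Rintegral _ _) _ => //.
      exact: bmeas_integrable.
    rewrite -[leRHS](expect_cst m1 M); apply: expect_le => //.
    - by case: (bFy y) => mF _; split; [exact: measurableT_comp|exists M => x; rewrite normr_id].
    - exact: bmeas_cst.
  apply/measurable_EFinP.
  rewrite (_ : _ \o _ = fun y => (\int[m1]_x (F (x, y))%:E)%E)//.
  by apply/funext => y /=; rewrite EFin_Rintegral.
have bGW : bmeas (fun w => \int[m1]_x F (x, W w)).
  by apply: (bmeas_comp _ bG); exact: measurable_funPT.
split => //; apply: EFin_inj; rewrite !EFin_Rintegral//; last exact: bmeas_comp bF.
transitivity (\int[distribution P XW]_z (F z)%:E)%E.
  rewrite integral_distribution//.
    by apply/measurable_EFinP; case: bF.
  by apply: bmeas_integrable; exact: bmeas_comp bF.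
transitivity (\int[m1 \x PW]_z (F z)%:E)%E.
  apply: eq_measure_integral => A mA _; apply/esym.
  by apply: product_measure_unique => // B C mB mC; exact: ind.
rewrite -(integral21_prod_meas1 iF) integral_distribution//.
  by apply: eq_integral => w _ /=; rewrite EFin_Rintegral.
rewrite (_ : _ \o _ = EFin \o (fun w => \int[m1]_x F (x, W w))).
  exact: bmeas_integrable.
by apply/funext => w /=; rewrite EFin_Rintegral.
Qed.

End Fubini.

Section Rest.
Context (R : realType) d dO (T : measurableType d) (Omega : measurableType dO)
  (P : probability Omega R) (n : nat) (X : 'I_n -> Omega -> T).

(* A pi-system generating the sigma-algebra of the [X l], [l != i]; [Omega] with
   that sigma-algebra is the second factor when [indep_expect] is applied. *)
Definition rest_rectangles (i : 'I_n) : set (set Omega) :=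
  [set B | exists A : 'I_n -> set T, (forall l, measurable (A l)) /\
     B = \bigcap_(l in [set l | l \in ~: [set i]%SET]) X l @^-1` A l].

Hypothesis mX : forall i, measurable_fun setT (X i).

Lemma rest_rectangles_measurable i : rest_rectangles i `<=` measurable.
Proof.
move=> _ [A [mA ->]]; apply: fin_bigcap_measurable => // l _.
by rewrite -[X in measurable X]setTI; exact: mX.
Qed.

Lemma rest_rectangles_setI i : setI_closed (rest_rectangles i).
Proof.
move=> _ _ [A [mA ->]] [B [mB ->]].
exists (fun l => A l `&` B l); split; first by move=> l; exact: measurableI.
by rewrite -bigcapI; apply: eq_bigcapr => l _; rewrite preimage_setI.
Qed.

Lemma rest_measurable_id i :
  measurable_fun setT (id : Omega -> g_sigma_algebraType (rest_rectangles i)).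
Proof.
move=> _ A mA; rewrite setTI preimage_id.
exact: (smallest_sub (@sigma_algebra_measurable _ Omega)
  (@rest_rectangles_measurable i) mA).
Qed.

Lemma rest_measurable i l : l != i ->
  measurable_fun setT (X l : g_sigma_algebraType (rest_rectangles i) -> T).
Proof.
move=> li _ A mA; rewrite setTI; apply: sub_sigma_algebra.
exists (fun k => if k == l then A else setT); split.
  by move=> k; case: ifP.
apply/seteqP; split=> [w Aw k /= _|w /(_ l) /=].
  by case: eqP => // ->.
by rewrite !inE eqxx; apply.
Qed.

Hypothesis ind : mutually_independent P X.

(** In [B], both sides are finite measures: [P] restricted to the event [X i] in [A], and a multiple
    of [P]. They agree on the pi-system of rectangles, hence on the generated sigma-algebra. *)
Lemma indep_rest i A B : measurable A ->
  <<s rest_rectangles i >> B ->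
  P (X i @^-1` A `&` B) = (P (X i @^-1` A) * P B)%E.
Proof.
move=> mA; have mXA : measurable (X i @^-1` A).
  by rewrite -[X in measurable X]setTI; exact: mX.
have pA : 0 <= fine (P (X i @^-1` A)) by rewrite fine_ge0.
have PA : P (X i @^-1` A) = (fine (P (X i @^-1` A)))%:E.
  by rewrite fineK// fin_num_measure.
rewrite setIC PA.
apply: (@g_sigma_algebra_measure_unique _ _ _ (rest_rectangles i)
  (@rest_rectangles_measurable i) (fun=> setT) _ _
  (mrestr P mXA) (mscale (NngNum pA) P)) => //.
- move=> _; exists (fun=> setT); split => //.
  by apply/seteqP; split.
- by rewrite bigcup_const//; exists 0%N.
- exact: rest_rectangles_setI.
- move=> _ [C [mC ->]]; rewrite /mrestr.
  set Q := bigcap _ _; transitivity (P (X i @^-1` A) * P Q)%E; last first.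
    by rewrite [in LHS]PA.
  rewrite {}/Q.
  (* Inserting [A] at index [i] makes the intersection a rectangle over all indices, to which mutual
     independence applies. *)
  pose C' l := if l == i then A else C l.
  have mC' l : measurable (C' l) by rewrite /C'; case: ifP.
  have iC : [set: 'I_n]%SET = (i |: ~: [set i])%SET.
    by apply/setP => l; rewrite !inE orbN.
  rewrite (ind _ mC) /=.
  transitivity (P (\bigcap_(l in [set l | l \in [set: 'I_n]%SET]) X l @^-1` C' l)).
    congr (P _).
    apply/seteqP; split=> [w [Cw Aw] l _|w Cw].
      rewrite /C' /=; case: eqP => [->//|/eqP li].
      by apply: (Cw l); rewrite /= !inE.
    split; last by have := Cw i; rewrite /C' /= eqxx; apply; rewrite inE.
    move=> l; rewrite /= !inE => li.
    by have := Cw l; rewrite /C' /= (negPf li); apply; rewrite inE.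
  rewrite (ind _ mC') iC big_setU1 /=; last by rewrite !inE eqxx.
  rewrite {1}/C' eqxx; congr (_ * _)%E; apply: eq_bigr => l.
  by rewrite !inE /C' => /negPf ->.
- move=> _; change (P (setT `&` X i @^-1` A) < +oo)%E; rewrite setTI.
  by rewrite -ge0_fin_numE// fin_num_measure.
Qed.

End Rest.

(** * Moments of the deviation matrix *)

Section Ghost.
Context (R : realType) d (T : measurableType d) (mu0 : probability T R) (J : nat).
Variables (U : T -> 'cV[R]_J) (L : R).
Hypothesis bU : bmeas_mx U.
Hypothesis UL : forall t, sqnorm (U t) <= L.

Let G t := U t *m (U t)^T.
Let Sigma := expect_mx mu0 G.
Let Y t := rank1_dev Sigma (U t).

Lemma bmeas_rank1 : bmeas_mx G.
Proof. by apply: bmeas_mxM => //; exact: bmeas_mx_tr. Qed.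

Lemma bmeas_dev : bmeas_mx Y.
Proof. by apply: bmeas_mxB; [exact: bmeas_rank1|exact: bmeas_mx_cst]. Qed.

Lemma rank1_tr t : (G t)^T = G t.
Proof. by rewrite trmx_mul trmxK. Qed.

Lemma gram_tr : Sigma^T = Sigma.
Proof.
apply/matrixP => i j; rewrite !mxE; apply: eq_Rintegral => t _.
by rewrite -[in LHS]rank1_tr mxE.
Qed.

Lemma dev_tr t : (Y t)^T = Y t.
Proof. by rewrite raddfB /= rank1_tr gram_tr. Qed.

Lemma expect_dev : expect_mx mu0 Y = 0.
Proof.
apply/matrixP => i j; rewrite !mxE.
transitivity (\int[mu0]_t (G t i j - Sigma i j)).
  by apply: eq_Rintegral => t _; rewrite mxE [X in _ + X]mxE.
rewrite expectB; [|exact: bmeas_rank1|exact: bmeas_cst].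
by rewrite expect_cst mxE subrr.
Qed.

(* Integrate [ghost_pair_le] over two independent points. *)
Lemma expect_dev_pow_le A q : A^T = A ->
  \int[mu0]_t \tr (Y t * (A + Y t) ^+ q.*2.+1) <=
  q.*2.+1%:R * L * \int[mu0]_t \tr ((G t + Sigma) * (A + Y t) ^+ q.*2).
Proof.
move=> sA.
have swap (c a b i k x y z : R) : a - b + (i - 0) <= c * (x + y + (k + z)) ->
  i - b + (a - 0) <= c * (k + y + (x + z)) by lra.
have ler_double (c i k : R) : i + i <= c * (k + k) -> i <= c * k by lra.
pose m t := (A + Y t) ^+ q.*2.+1; pose e t := (A + Y t) ^+ q.*2.
have bY := bmeas_dev; have bG := bmeas_rank1.
have bAY : bmeas_mx (fun t => A + Y t) by apply: bmeas_mxD => //; exact: bmeas_mx_cst.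
have bm : bmeas_mx m by exact: bmeas_mxX.
have be : bmeas_mx e by exact: bmeas_mxX.
pose c := q.*2.+1%:R * L.
pose I := \int[mu0]_t \tr (Y t * m t); pose K := \int[mu0]_t \tr (G t * e t).
have bYm : bmeas (fun t => \tr (Y t * m t)) by apply/bmeas_tr/bmeas_mxM.
have bGe : bmeas (fun t => \tr (G t * e t)) by apply/bmeas_tr/bmeas_mxM.
have bl (F : T -> 'M[R]_J) B : bmeas_mx F -> bmeas (fun t => \tr (B * F t)).
  by move=> bF; apply/bmeas_tr/bmeas_mxM => //; exact: bmeas_mx_cst.
have br (F : T -> 'M[R]_J) B : bmeas_mx F -> bmeas (fun t => \tr (F t * B)).
  by move=> bF; apply/bmeas_tr/bmeas_mxM => //; exact: bmeas_mx_cst.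
have pair s t : \tr (Y s * m s) - \tr (Y s * m t) + (\tr (Y t * m t) - \tr (Y t * m s))
    <= c * (\tr (G s * e s) + \tr (G s * e t) + (\tr (G t * e t) + \tr (G t * e s))).
  have := ghost_pair_le q sA gram_tr (L := L) (x := U s) (y := U t).
  rewrite -!sqnormE => /(_ (UL s) (UL t)).
  rewrite -/(Y s) -/(Y t) -/(m s) -/(m t) -/(e s) -/(e t) -/(G s) -/(G t) -/c.
  move: (Y s) (Y t) (m s) (m t) (e s) (e t) (G s) (G t) => ys yt ms mt es et gs gt.
  rewrite [(ys - yt) * _]mulrBl !mulrBr [(gs + gt) * _]mulrDl !mulrDr !mxtraceB !mxtraceD; lra.
(* Integrating over [t] kills the cross term [tr (Y t * m s)], as [Y] has mean zero. The remaining
   [- 0] keeps the shape needed for the integration over [s]. *)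
have half s : \tr (Y s * m s) - \tr (Y s * expect_mx mu0 m) + (I - 0)
    <= c * (\tr (G s * e s) + \tr (G s * expect_mx mu0 e) + (K + \tr (Sigma * e s))).
  have [b1 E1] := expect_affineB mu0 (\tr (Y s * m s))
     (bl _ (Y s) bm) bYm (br _ (m s) bY).
  have [b2 E2] := expect_affineD mu0 c (\tr (G s * e s))
     (bl _ (G s) be) bGe (br _ (e s) bG).
  have := expect_le mu0 b1 b2 (pair s); rewrite E1 E2.
  rewrite (expect_trMl _ _ bm) (expect_trMl _ _ be) (expect_trMr _ _ bG).
  by rewrite (expect_trMr _ _ bY) expect_dev mul0r mxtrace0.
have [b1 E1] := expect_affineB mu0 (I - 0) (br _ (expect_mx mu0 m) bY) bYm
   (bmeas_cst T 0).
have [b2 E2] := expect_affineD mu0 c K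
   (br _ (expect_mx mu0 e) bG) bGe (bl _ Sigma be).
have := expect_le mu0 b1 b2 _; rewrite E1 E2 expect_cst.
rewrite (expect_trMl _ _ be) (expect_trMr _ _ bG).
rewrite (expect_trMr _ _ bY) expect_dev mul0r mxtrace0 -/I -/K -/Sigma !subr0.
have -> : \int[mu0]_t \tr ((G t + Sigma) * (A + Y t) ^+ q.*2) =
    K + \tr (Sigma * expect_mx mu0 e).
  rewrite -(expect_trMl _ _ be) /K -(expectD mu0 bGe (bl _ Sigma be)).
  by apply: eq_Rintegral => t _; rewrite mulrDl mxtraceD.
rewrite -/c -/I => H.
(* Both integrations together give twice the claim; [swap] only reorders the terms of [half]. *)
apply: ler_double; apply: H => s; exact: swap (half s).
Qed.

End Ghost.

Section Moments.
Context (R : realType) d dO (T : measurableType d) (Omega : measurableType dO)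
  (mu0 : probability T R) (P : probability Omega R) (J n : nat).
Variables (U : T -> 'cV[R]_J) (L : R) (X : 'I_n -> Omega -> T).
Hypothesis bU : bmeas_mx U.
Hypothesis UL : forall t, sqnorm (U t) <= L.
Hypothesis mX : forall i, measurable_fun setT (X i).
Hypothesis lawX : forall i A, measurable A -> P (X i @^-1` A) = mu0 A.
Hypothesis indX : mutually_independent P X.

Let G t := U t *m (U t)^T.
Let Sigma := expect_mx mu0 G.
Let Y t := rank1_dev Sigma (U t).
Let S w := \sum_i Y (X i w).

Lemma sum_dev_tr w : (S w)^T = S w.
Proof. by rewrite raddf_sum; apply: eq_bigr => i _; exact: dev_tr. Qed.

Lemma bmeas_sum_dev : bmeas_mx S.
Proof. by apply: bmeas_mx_sum => i _; apply: bmeas_mx_comp (bmeas_dev mu0 bU). Qed.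

(** Write [S = A + Y (X i)], where [A] depends on the other sample points only. By independence
    [X i] can be integrated first with [A] frozen, which is [expect_dev_pow_le]. *)
Lemma expect_dev_sum_pow_le i q :
  \int[P]_w \tr (Y (X i w) * S w ^+ q.*2.+1) <=
  q.*2.+1%:R * L * \int[P]_w \tr ((G (X i w) + Sigma) * S w ^+ q.*2).
Proof.
pose Om := g_sigma_algebraType (rest_rectangles X i).
pose Xi : {mfun Omega >-> T} :=
  HB.pack (X i) (isMeasurableFun.Build _ _ _ _ _ (mX i)).
have mW : measurable_fun setT (id : Omega -> Om) by exact: rest_measurable_id.
pose W : {mfun Omega >-> Om} :=
  HB.pack (id : Omega -> Om) (isMeasurableFun.Build _ _ _ _ _ mW).
have ind A B : measurable A -> measurable B ->
    P (Xi @^-1` A `&` W @^-1` B) = (mu0 A * P (W @^-1` B))%E.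
  by move=> mA mB; rewrite -(lawX i mA); apply: indep_rest.
pose A (w : Om) := \sum_(l | l != i) Y (X l w).
have sA w : (A w)^T = A w.
  by rewrite raddf_sum; apply: eq_bigr => l _; exact: dev_tr.
have SE w : S w = A w + Y (X i w) by rewrite /S (bigD1 i)//= addrC.
have bA : bmeas_mx A.
  apply: bmeas_mx_sum => l li.
  by apply: bmeas_mx_comp (bmeas_dev mu0 bU); exact: rest_measurable.
have bY1 : bmeas_mx (fun z : T * Om => Y z.1).
  by apply: (bmeas_mx_comp _ (bmeas_dev mu0 bU)); exact: measurable_fst.
have bG1 : bmeas_mx (fun z : T * Om => G z.1).
  by apply: (bmeas_mx_comp _ (bmeas_rank1 bU)); exact: measurable_fst.
have bA2 : bmeas_mx (fun z : T * Om => A z.2).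
  by apply: (bmeas_mx_comp _ bA); exact: measurable_snd.
have bAY k : bmeas_mx (fun z : T * Om => (A z.2 + Y z.1) ^+ k).
  by apply/bmeas_mxX/bmeas_mxD.
have bF1 : bmeas (fun z : T * Om => \tr (Y z.1 * (A z.2 + Y z.1) ^+ q.*2.+1)).
  by apply/bmeas_tr/bmeas_mxM.
have bF2 : bmeas (fun z : T * Om => \tr ((G z.1 + Sigma) * (A z.2 + Y z.1) ^+ q.*2)).
  apply/bmeas_tr/bmeas_mxM => //; apply: bmeas_mxD => //; exact: bmeas_mx_cst.
have [b1 E1] := indep_expect ind bF1; have [b2 E2] := indep_expect ind bF2.
rewrite /= in b1 E1 b2 E2.
under eq_Rintegral => w _ do rewrite SE.
under [in leRHS]eq_Rintegral => w _ do rewrite SE.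
rewrite E1 E2 -(expectZ _ _ b2).
apply: expect_le => // [|w]; first exact: bmeasM (bmeas_cst _ _) b2.
exact: (expect_dev_pow_le mu0 bU UL q (sA w)).
Qed.

Let phi q := \int[P]_w \tr (S w ^+ q.*2).

Lemma bmeas_sum_dev_pow k : bmeas (fun w => \tr (S w ^+ k)).
Proof. by apply/bmeas_tr/bmeas_mxX/bmeas_sum_dev. Qed.

Lemma moment_step q (a : R) : a = q.*2.+1%:R * L -> 0 < L ->
  phi q.+1 <= (a ^+ 2 + 4 * (n%:R * a * opnorm Sigma)) * phi q.
Proof.
move=> aE L0; have a0 : 0 < a by rewrite aE mulr_gt0.
have bG i : bmeas (fun w => \tr ((G (X i w) + Sigma) * S w ^+ q.*2)).
  apply/bmeas_tr/bmeas_mxM; last exact/bmeas_mxX/bmeas_sum_dev.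
  apply: bmeas_mxD; last exact: bmeas_mx_cst.
  exact: bmeas_mx_comp (bmeas_rank1 bU).
have bY i : bmeas (fun w => \tr (Y (X i w) * S w ^+ q.*2.+1)).
  apply/bmeas_tr/bmeas_mxM; last exact/bmeas_mxX/bmeas_sum_dev.
  exact: bmeas_mx_comp (bmeas_dev mu0 bU).
have H1 : phi q.+1 <= a * \int[P]_w \sum_i \tr ((G (X i w) + Sigma) * S w ^+ q.*2).
  rewrite expect_sum// mulr_sumr.
  have -> : phi q.+1 = \sum_i \int[P]_w \tr (Y (X i w) * S w ^+ q.*2.+1).
    rewrite -expect_sum//; apply: eq_Rintegral => w _.
    by rewrite doubleS exprS mulr_suml raddf_sum.
  by apply: ler_sum => i _; rewrite aE; exact: expect_dev_sum_pow_le.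
have b1 := bmeas_sum_dev_pow q.*2.+2; have b2 := bmeas_sum_dev_pow q.*2.
pose o := opnorm Sigma.
(* The matrices [G (X i) + Sigma] add up to [S + 2 n Sigma]. The weight [a] in [mxtr_pow_odd_le] is
   chosen so that, after multiplication by [a], exactly half of [phi q.+1] appears on the right. *)
have pt w : \sum_i \tr ((G (X i w) + Sigma) * S w ^+ q.*2) <=
    (2^-1 * a^-1) * \tr (S w ^+ q.*2.+2) +
    (a / 2 + 2 * n%:R * o) * \tr (S w ^+ q.*2).
  have sS := sum_dev_tr w.
  have -> : \sum_i \tr ((G (X i w) + Sigma) * S w ^+ q.*2) =
      \tr (S w ^+ q.*2.+1) + 2 * n%:R * \tr (Sigma * S w ^+ q.*2).
    rewrite -raddf_sum /= -mulr_suml.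
    have -> : \sum_i (G (X i w) + Sigma) = S w + (2 * n%:R) *: Sigma.
      rewrite /S /Y /rank1_dev sumrB big_split /= sumr_const card_ord.
      by rewrite mulrC mulr_natr -[_ *+ 2]mulr_natr -natrM scaler_nat muln2 -addnn mulrnDr
                 addrA subrK.
    by rewrite mulrDl mxtraceD -exprS -scaleMl mxtraceZ.
  have h1 := mxtr_pow_odd_le q sS a0.
  have h2 : \tr (Sigma * S w ^+ q.*2) <= o * \tr (S w ^+ q.*2).
    have -> : o * \tr (S w ^+ q.*2) = \tr (o%:M * S w ^+ q.*2).
      by rewrite -mxtraceZ -mulmxE mul_scalar_mx.
    apply: mxtr_psd_le => //; apply/psd_scalar_sub => v.
    exact: le_trans (ler_norm _) (quad_le_opnorm _ _).
  have n0 : 0 <= 2 * n%:R :> R by rewrite mulr_ge0.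
  have := ler_wpM2l n0 h2; move: h1; clear.
  move: (\tr _) (\tr _) (\tr _) (\tr _) (a^-1) (n%:R) => x y z t b k; lra.
have bs : bmeas (fun w => \sum_i \tr ((G (X i w) + Sigma) * S w ^+ q.*2)).
  by apply: bmeas_sum => i _; exact: bG.
have bb1 := bmeasM (bmeas_cst Omega (2^-1 * a^-1)) b1.
have bb2 := bmeasM (bmeas_cst Omega (a / 2 + 2 * n%:R * o)) b2.
have := expect_le P bs (bmeasD bb1 bb2) pt.
rewrite (expectD P bb1 bb2) !expectZ// => H2.
have := le_trans H1 (ler_wpM2l (ltW a0) H2).
rewrite -[\int[P]_x \tr (S x ^+ q.*2.+2)]/(phi q.+1) -[\int[P]_x \tr (S x ^+ q.*2)]/(phi q).
rewrite -/o.
have -> : a * (2^-1 * a^-1 * phi q.+1 + (a / 2 + 2 * n%:R * o) * phi q) =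
   2^-1 * phi q.+1 + (a ^+ 2 / 2 + 2 * (n%:R * a * o)) * phi q.
  by field; rewrite gt_eqF.
move: (phi q.+1) (phi q) (a ^+ 2) (n%:R * a * o) => u v y z; lra.
Qed.

(** The recursion starts from the trace of the identity, [J]. Its factor grows with [q], so for
    [q < p] the value with [2 q + 1] is replaced by the common larger one with [2 p]. *)
Lemma moment_le p : 0 < L ->
  phi p <= J%:R * ((p.*2%:R * L) ^+ 2 + 4 * (n%:R * (p.*2%:R * L) * opnorm Sigma)) ^+ p.
Proof.
move=> L0; have o0 := opnorm_ge0 Sigma.
set K := _ ^+ 2 + _.
have K0 : 0 <= K by rewrite addr_ge0 ?sqr_ge0// !mulr_ge0// ltW.
suff H q : (q <= p)%N -> phi q <= J%:R * K ^+ q by exact: H.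
elim: q => [|q IH] qp.
  rewrite /phi double0 expr0 mulr1 /=.
  by under eq_Rintegral => w _ do rewrite expr0 mxtrace1; rewrite expect_cst.
have phi0 : 0 <= phi q.
  apply: Rintegral_ge0 => w _.
  rewrite -addnn exprD -[X in X * _](_ : (S w ^+ q)^T = _); last first.
    by rewrite trmxX sum_dev_tr.
  exact: mxtr_frob_ge0.
apply: le_trans (@moment_step q _ erefl L0) _.
rewrite [K ^+ q.+1]exprS [X in _ <= X]mulrCA; apply: le_trans (ler_wpM2l K0 (IH (ltnW qp))).
rewrite ler_wpM2r//.
have le : q.*2.+1%:R * L <= p.*2%:R * L.
  rewrite ler_pM2r// ler_nat; apply: (@leq_trans q.+1.*2); first by rewrite doubleS.
  by rewrite leq_double.
rewrite /K lerD// ?ler_pM2l// ?ler_wpM2r// ?ler_wpM2l//.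
by rewrite ler_sqr ?nnegrE ?mulr_ge0// ltW.
Qed.

End Moments.

(** * Measurability, densities and the tail bound *)

Section MeasurableSpectrum.
Context (R : realType).

(** Rational vectors are dense and the form is continuous; this leaves countably many conditions, as
    measurability requires. *)
Lemma psd_of_rat n (B : 'M[R]_n) :
  (forall v : 'cV[rat]_n, 0 <= quad B (map_mx ratr v)) -> psd B.
Proof.
move=> pB v.
have : forall kj : nat * 'I_n, exists r : rat,
    `|v kj.2 0 - ratr r| < kj.1.+1%:R^-1 :> R.
  move=> [k j] /=; set e := (_ : R)^-1.
  have e0 : 0 < e by rewrite invr_gt0.
  have [r] : exists r : rat, ratr r \in `]v j 0 - e, v j 0 + e[.
    by apply: rat_in_itvoo; rewrite ltrBlDr -addrA ltrDl addr_gt0.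
  by rewrite in_itv /= => /andP[h1 h2]; exists r; rewrite ltr_norml; apply/andP; split; lra.
move=> /choice[r hr]; pose u k : 'cV[rat]_n := \col_j r (k, j).
have cu j : (map_mx ratr (u k)) j 0 @[k --> \oo] --> v j 0.
  apply/cvgrPdist_lt => e e0; near=> k.
  rewrite !mxE; apply: lt_trans (hr (k, j)) _.
  by near: k; exact: (near_infty_natSinv_lt (PosNum e0)).
have cq : quad B (map_mx ratr (u k)) @[k --> \oo] --> quad B v.
  under eq_fun do rewrite quadE.
  rewrite quadE; apply: cvg_big => [|j _]; first exact: add_continuous.
  apply: cvg_big => [|k _]; first exact: add_continuous.
  by apply: cvgM (cu k); apply: cvgMl.
rewrite -(cvg_lim _ cq)//; apply: limr_ge; first by apply/cvg_ex; exists (quad B v).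
by apply: nearW => k; exact: pB.
Unshelve. all: by end_near. Qed.

Context d (T : measurableType d).

Definition meas_mx m n (F : T -> 'M[R]_(m, n)) :=
  forall i j, measurable_fun setT (fun x => F x i j).

Lemma measurable_quad n (B : T -> 'M[R]_n) v :
  meas_mx B -> measurable_fun setT (fun x => quad (B x) v).
Proof.
move=> mB; under eq_fun do rewrite quadE.
apply: measurable_sum => j; apply: measurable_sum => k.
apply: measurable_funM => //; apply: measurable_funM => //; exact: mB.
Qed.

Lemma measurable_psd n (B : T -> 'M[R]_n) :
  meas_mx B -> measurable [set x | psd (B x)].
Proof.
move=> mB.
(* Rational vectors are enumerated by their codes; a number that codes no vector imposes no
   condition. *)
pose E k := if unpickle k is Some v
  then [set x | 0 <= quad (B x) (map_mx ratr (v : 'cV[rat]_n))] else setT.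
rewrite (_ : [set x | _] = \bigcap_k E k).
  apply: bigcapT_measurable => k; rewrite /E; case: unpickle => // v.
  rewrite [X in measurable X](_ : _ =
      (fun x => quad (B x) (map_mx ratr v)) @^-1` `[0, +oo[).
    by rewrite -[X in measurable X]setTI; apply: measurable_quad.
  by apply/seteqP; split=> x /=; rewrite in_itv /= andbT.
apply/seteqP; split=> [x px k _|x Ex].
  by rewrite /E; case: unpickle => // v; exact: px.
apply: psd_of_rat => v; have := Ex (pickle v) I.
by rewrite /E pickleK.
Qed.

Lemma meas_mxB m n (F G : T -> 'M[R]_(m, n)) :
  meas_mx F -> meas_mx G -> meas_mx (fun x => F x - G x).
Proof.
by move=> bF bG i j; under eq_fun do rewrite !mxE; exact: measurable_funB.
Qed.

Lemma meas_mx_cst m n (A : 'M[R]_(m, n)) : meas_mx (fun=> A).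
Proof. by move=> i j; exact: measurable_cst. Qed.

Lemma measurable_opnorm_le m n (F : T -> 'M[R]_(m, n)) t : 0 <= t ->
  meas_mx F -> measurable [set x | opnorm (F x) <= t].
Proof.
move=> t0 mF; rewrite (_ : [set x | _] = [set x | psd ((t ^+ 2)%:M - (F x)^T *m F x)]).
  apply/measurable_psd/meas_mxB; first exact: meas_mx_cst.
  move=> i j; under eq_fun do rewrite !mxE.
  apply: measurable_sum => k; apply: measurable_funM; last exact: mF.
  by under eq_fun do rewrite mxE; exact: mF.
by apply/seteqP; split=> x /=; rewrite opnorm_le_psd.
Qed.

End MeasurableSpectrum.

Section Density.
Import HBNNSimple.
Context (R : realType) d (T : measurableType d)
  (mu nu : {measure set T -> \bar R}) (p : T -> R).
Hypothesis mp : measurable_fun setT p.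
Hypothesis p0 : forall x, 0 <= p x.
Hypothesis nuE : forall A, measurable A -> nu A = (\int[mu]_(x in A) (p x)%:E)%E.

Local Open Scope ereal_scope.

(** The density formula is given on sets, which settles indicators. Simple functions follow by
    linearity, and [f] by monotone convergence on both sides. *)
Lemma ge0_integral_density (f : T -> \bar R) :
  measurable_fun setT f -> (forall x, 0 <= f x) ->
  \int[nu]_x f x = \int[mu]_x (f x * (p x)%:E).
Proof.
move=> mf f0; pose g x := (p x)%:E.
have mg : measurable_fun setT g by exact/measurable_EFinP.
have g0 x : 0 <= g x by rewrite lee_fin.
pose h := nnsfun_approx measurableT mf.
have -> : \int[nu]_x f x = lim (\int[nu]_x (h n x)%:E @[n --> \oo]).
  have fE x : f x = lim ((h n x)%:E @[n --> \oo]).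
    by apply/esym/cvg_lim => //; exact: cvg_nnsfun_approx.
  under eq_integral => x _ do rewrite fE.
  apply: monotone_convergence => //.
  - by move=> n; apply/measurable_EFinP.
  - by move=> n x _ /=; rewrite lee_fin.
  - by move=> x _ a b ab; rewrite lee_fin; exact/lefP/nd_nnsfun_approx.
have -> : \int[mu]_x (f x * g x) =
    lim (\int[mu]_x ((h n x)%:E * g x) @[n --> \oo]).
  have fg x : (f x * g x) = lim (((h n x)%:E * g x) @[n --> \oo]).
    by apply/esym/cvg_lim => //; apply: cvgeZr => //; exact: cvg_nnsfun_approx.
  under eq_integral => x _ do rewrite fg.
  apply: monotone_convergence => [//| | |].
  - by move=> n; apply/emeasurable_funM => //; exact/measurable_EFinP.
  - by move=> n x _ /=; rewrite mule_ge0 ?lee_fin.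
  - by move=> x _ a b ab/=; rewrite lee_wpmul2r ?lee_fin//; exact/lefP/nd_nnsfun_approx.
suff suf n : \int[mu]_x ((h n x)%:E * g x) = \int[nu]_x (h n x)%:E.
  by under eq_fun do rewrite -suf.
have indich r : measurable_fun setT (fun x => (r * \1_(h n @^-1` [set r]) x)%:E).
  by apply: (measurable_comp measurableT) => //; exact: measurable_funM.
transitivity (\int[nu]_x
   (\sum_(y \in range (h n)) (y * \1_(h n @^-1` [set y]) x)%:E)); last first.
  by apply: eq_integral => t _; rewrite /= fimfunE -fsumEFin.
rewrite ge0_integral_fsum//; last by move=> r x _; exact: nnfun_muleindic_ge0.
transitivity (\int[mu]_x (\sum_(y \in range (h n))
    (y * \1_(h n @^-1` [set y]) x)%:E * g x)).
  under [RHS]eq_integral => x _.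
    rewrite -ge0_mule_fsuml => [|y]; last exact: nnfun_muleindic_ge0.
    rewrite fsumEFin // -(fimfunE _ x); over.
  by [].
rewrite ge0_integral_fsum//; last 2 first.
  - by move=> r; apply: emeasurable_funM.
  - by move=> r x _; rewrite mule_ge0// nnfun_muleindic_ge0.
apply: eq_fsbigr => r rhn.
under [RHS]eq_integral do rewrite EFinM.
rewrite integralZl_indic_nnsfun//.
under eq_integral do rewrite EFinM -muleA.
have r0 : 0 <= r%:E by move: rhn; rewrite inE => -[t _ <-]; rewrite lee_fin.
rewrite ge0_integralZl//.
- under eq_integral do rewrite muleC.
  rewrite (eq_integral (g \_ (h n @^-1` [set r]))); last first.
    by move=> x xE; rewrite epatch_indic.
  by rewrite -integral_mkcond -nuE// integral_indic// setIT.
- by apply: emeasurable_funM => //; exact/measurable_EFinP.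
- by move=> x _; rewrite mule_ge0 ?lee_fin.
Qed.

End Density.

(** A bound [M] of [|f|] writes [f] as the difference of the nonnegative bounded functions [f + M]
    and [M], which reduces to [ge0_integral_density]. *)
Lemma Rintegral_density (R : realType) d (T : measurableType d)
    (mu : {measure set T -> \bar R}) (nu : probability T R) (p f : T -> R) :
  measurable_fun setT p -> (forall x, 0 <= p x) ->
  (forall A, measurable A -> nu A = (\int[mu]_(x in A) (p x)%:E)%E) ->
  bmeas f -> \int[nu]_x f x = \int[mu]_x (f x * p x).
Proof.
move=> mp p0 nuE bf; have [M fM] := bf.2.
have M0 : 0 <= M by apply: le_trans (fM point).
have dens g : bmeas g -> (forall x, 0 <= g x) ->
    mu.-integrable setT (EFin \o (fun x => g x * p x)) /\
    \int[nu]_x g x = \int[mu]_x (g x * p x).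
  move=> bg g0.
  have mg : measurable_fun setT (EFin \o g) by apply/measurable_EFinP; case: bg.
  have E : (\int[mu]_x (g x * p x)%:E = \int[nu]_x (g x)%:E)%E.
    by rewrite (ge0_integral_density mp p0 nuE mg)// => x; rewrite lee_fin.
  split; last by rewrite /Rintegral E.
  apply/integrableP; split.
    by apply/measurable_EFinP/measurable_funM => //; case: bg.
  under eq_integral => x _ do rewrite /= ger0_norm ?mulr_ge0//.
  by rewrite E -EFin_Rintegral// ltry.
have [i1 e1] := dens _ (bmeasD bf (bmeas_cst T M))
  (fun x => ltac:(by have := fM x; rewrite ler_norml => /andP[]; rewrite -subr_ge0 opprK)).
have [i2 e2] := dens _ (bmeas_cst T M) (fun=> M0).
transitivity (\int[nu]_x (f x + M) - \int[nu]_x M).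
  by rewrite expectD ?expect_cst ?addrK//; exact: bmeas_cst.
rewrite e1 e2 -RintegralB//; apply: eq_Rintegral => x _.
by rewrite mulrDl addrK.
Qed.

Section Tail.
Context (R : realType) d dO (T : measurableType d) (Omega : measurableType dO)
  (mu0 : probability T R) (P : probability Omega R) (J n : nat).
Variables (U : T -> 'cV[R]_J) (L : R) (X : 'I_n -> Omega -> T).
Hypothesis bU : bmeas_mx U.
Hypothesis UL : forall t, sqnorm (U t) <= L.
Hypothesis mX : forall i, measurable_fun setT (X i).
Hypothesis lawX : forall i A, measurable A -> P (X i @^-1` A) = mu0 A.
Hypothesis indX : mutually_independent P X.

Let Sigma := expect_mx mu0 (fun t => U t *m (U t)^T).
Let S w := \sum_i rank1_dev Sigma (U (X i w)).

Lemma measurable_tail t : 0 <= t -> measurable [set w | t < opnorm (S w)].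
Proof.
move=> t0; rewrite (_ : [set w | _] = ~` [set w | opnorm (S w) <= t]).
  apply: measurableC; apply: measurable_opnorm_le => // i j.
  by case: (bmeas_sum_dev mu0 bU mX i j).
by apply/seteqP; split=> w /=; [rewrite ltNge => /negP|move/negP; rewrite -ltNge].
Qed.

(** Markov's inequality in pointwise form: on the event the trace of [S^(2p)] is at least [t^(2p)],
    and off it the trace is nonnegative. *)
Lemma tail_moment (t : R) p : 0 < t ->
  (P [set w | t < opnorm (S w)]%R <=
   ((t ^+ p.*2)^-1 * \int[P]_w \tr (S w ^+ p.*2))%:E)%E.
Proof.
move=> t0; set A := [set w | _].
have mA : measurable A by apply: measurable_tail; exact: ltW.
have tp : 0 < t ^+ p.*2 by rewrite exprn_gt0.
have bA : bmeas (\1_A : Omega -> R).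
  split; first exact: measurable_indic.
  by exists 1 => w; rewrite indicE; case: (w \in A); rewrite ?normr1 ?normr0.
have bS := bmeas_sum_dev_pow mu0 bU mX p.*2.
have EA : P A = (\int[P]_w (\1_A w : R))%:E.
  by rewrite EFin_Rintegral// integral_indic// setIT.
rewrite EA lee_fin -(expectZ _ _ bS); apply: expect_le => // [|w].
  exact: bmeasM (bmeas_cst _ _) bS.
have sS := sum_dev_tr mu0 U X w.
rewrite ler_pdivlMl// indicE; have [wA|_] := boolP (w \in A).
  rewrite mulr1; apply: lt_opnorm_mxtr_pow (ltW t0) _ => //.
  by move: wA; rewrite inE.
rewrite mulr0 -addnn exprD -[X in X * _](_ : (S w ^+ p)^T = _).
  exact: mxtr_frob_ge0.
by rewrite trmxX sS.
Qed.

Lemma expR_N1_ge : 4^-1 <= expR (-1) :> R.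
Proof.
have h : 2^-1 <= expR (- 2^-1) :> R.
  by apply: le_trans (expR_ge1Dx _); lra.
have -> : -1 = - 2^-1 + - 2^-1 :> R by lra.
have h0 : 0 <= 2^-1 :> R by [].
by rewrite expRD; have := ler_pM h0 h0 h h; apply: le_trans; lra.
Qed.

(** In the application [k] is [p_+ / p_-], so the threshold is [n] times the allowed deviation
    [|Sigma| p_- / (2 p_+)]. *)
Lemma tail_exp (k : R) : (0 < n)%N -> (0 < J)%N -> 0 < L -> 1 <= k ->
  let s := opnorm Sigma in let m := n%:R * s / (k ^+ 2 * L) in
  0 < s -> ln J%:R <= 400^-1 * m ->
  (P [set w | n%:R * s / (2 * k) < opnorm (S w)]%R <= (expR (1 - 400^-1 * m))%:E)%E.
Proof.
move=> n0 J0 L0 k1 s m s0 lnJ.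
(* Used with [a = ln J], [x = m], [y = p]: of the decay [m / 200], one half pays for the dimension
   [J] and the other half is the final exponent. *)
have expo (a x y : R) : a <= 400^-1 * x -> x / 200 < y + 1 ->
  a + - y <= 1 - 400^-1 * x by lra.
(* Numerically, [1 / 10000 + 4 / 100] is below [1 / 16]. *)
have num (q x y : R) : x <= q * (q / 100) -> y <= (q / 100) ^+ 2 ->
    y + 4 * x <= (q / 2) ^+ 2 * 4^-1.
  by have := sqr_ge0 q; rewrite !expr2; lra.
have k0 : 0 < k by apply: lt_le_trans k1.
have nR0 : 0 < n%:R :> R by rewrite ltr0n.
pose q := n%:R * s / k; have q0 : 0 < q by rewrite divr_gt0// mulr_gt0.
have m0 : 0 < m by rewrite divr_gt0 ?mulr_gt0// exprn_gt0.
(* With [p <= m / 200] the factor of [moment_le] is at most a quarter of the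
   squared threshold, and [1 / 4 <= exp (-1)]. *)
pose p := Num.trunc (m / 200).
have /andP[pm mp] : p%:R <= m / 200 < p.+1%:R.
  by apply: Num.Theory.truncn_itv; rewrite divr_ge0// ltW.
have -> : n%:R * s / (2 * k) = q / 2 by rewrite /q; field; rewrite gt_eqF.
have t0 : 0 < q / 2 by rewrite divr_gt0.
apply: le_trans (tail_moment p t0) _; rewrite lee_fin.
have M := moment_le bU UL mX lawX indX p L0.
pose b := p.*2%:R * L.
have b0 : 0 <= b by rewrite mulr_ge0// ltW.
have bE : b <= q / (100 * k).
  have -> : q / (100 * k) = (2 * L) * (m / 200).
    by rewrite /q /m; field; rewrite !gt_eqF.
  have -> : b = (2 * L) * p%:R by rewrite /b -muln2 natrM; ring.
  by rewrite ler_pM2l// mulr_gt0.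
have bkq : b * k <= q / 100.
  by apply: le_trans (ler_wpM2r (ltW k0) bE) _; rewrite invfM mulrA divfK ?gt_eqF.
have bq : b <= q / 100 by apply: le_trans bkq; rewrite ler_peMr.
pose K := b ^+ 2 + 4 * (n%:R * b * s).
have K0 : 0 <= K by rewrite addr_ge0 ?sqr_ge0// !mulr_ge0// ltW.
have KE : K <= (q / 2) ^+ 2 * 4^-1.
  have -> : K = b ^+ 2 + 4 * (q * (b * k)).
    by rewrite /K /q; field; rewrite gt_eqF.
  have h1 := ler_wpM2l (ltW q0) bkq.
  have q1 : 0 <= q / 100 by rewrite divr_ge0// ltW.
  have h2 : b ^+ 2 <= (q / 100) ^+ 2 by rewrite ler_sqr ?nnegrE.
  exact: num h1 h2.
have KpE : K ^+ p <= (q / 2) ^+ p.*2 * expR (- p%:R).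
  apply: le_trans (_ : ((q / 2) ^+ 2 * 4^-1) ^+ p <= _).
    by rewrite lerXn2r ?nnegrE// mulr_ge0 ?sqr_ge0.
  rewrite exprMn -exprM mul2n ler_pM2l ?exprn_gt0//.
  have -> : - p%:R = -1 * p%:R :> R by rewrite mulN1r.
  by rewrite expRM_natr lerXn2r ?nnegrE ?expR_ge0// expR_N1_ge.
rewrite ler_pdivrMl ?exprn_gt0//.
apply: le_trans M _; apply: le_trans (ler_wpM2l (ler0n _ _) KpE) _.
rewrite mulrCA ler_pM2l ?exprn_gt0//.
have -> : J%:R = expR (ln J%:R) :> R by rewrite lnK// posrE ltr0n.
by rewrite -expRD ler_expR; apply: expo lnJ _; rewrite natr1.
Qed.

End Tail.

(** * Reduction to bounded vectors *)

Lemma psd_of_opnorm_sub (R : realType) n (A S : 'M[R]_n) (pm pp : R) :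
  S^T = S -> 0 < pm -> pm <= pp -> psd (S - pm%:M) -> psd (pp%:M - S) ->
  opnorm (A - S) <= pm / (2 * pp) * opnorm S ->
  psd (A - (pm / 2)%:M) /\ psd ((pp + pm / 2)%:M - A).
Proof.
move=> sS pm0 pmp pS Sp le.
have pp0 : 0 < pp by apply: lt_le_trans pmp.
have psdS : psd S.
  move=> v; have /psd_sub_scalar /(_ v) := pS; apply: le_trans.
  by rewrite mulr_ge0 ?sqnorm_ge0// ltW.
have sp : opnorm S <= pp by apply: psd_opnorm_le => //; exact: ltW.
have le2 : opnorm (A - S) <= pm / 2.
  apply: le_trans le _; have -> : pm / 2 = pm / (2 * pp) * pp.
    by field; rewrite gt_eqF.
  by rewrite ler_wpM2l// divr_ge0 ?mulr_ge0// ltW.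
have q v : `|quad A v - quad S v| <= pm / 2 * sqnorm v.
  rewrite -quadB; apply: le_trans (quad_le_opnorm _ _) _.
  by rewrite ler_wpM2r// sqnorm_ge0.
split; [apply/psd_sub_scalar => v|apply/psd_scalar_sub => v].
  have /psd_sub_scalar /(_ v) := pS; have := q v; rewrite ler_norml => /andP[h _].
  by move: h; move: (quad A v) (quad S v) (sqnorm v) => a b c; lra.
have /psd_scalar_sub /(_ v) := Sp; have := q v; rewrite ler_norml => /andP[_ h].
by move: h; move: (quad A v) (quad S v) (sqnorm v) => a b c; lra.
Qed.

Lemma emp_gram_tr (R : realType) T J n (u : 'I_J -> T -> R) (X : 'I_n -> T) :
  (emp_gram u X)^T = emp_gram u X.
Proof.
apply/matrixP => j k; rewrite !mxE; congr (_ * _).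
by apply: eq_bigr => i _; rewrite mulrC.
Qed.

Lemma meas_emp_gram (R : realType) d (T : measurableType d) dO
    (Omega : measurableType dO) (J n : nat) (u : 'I_J -> T -> R) (X : 'I_n -> Omega -> T) :
  (forall j, measurable_fun setT (u j)) -> (forall i, measurable_fun setT (X i)) ->
  meas_mx (fun w => emp_gram u (fun i => X i w)).
Proof.
move=> mu mX j k; under eq_fun do rewrite mxE.
apply: measurable_funM => //; apply: measurable_sum => i.
by apply: measurable_funM; apply: measurableT_comp.
Qed.

(** The semidefinite form of the eigenvalue event serves both its measurability and the inclusion of
    events. Positive dimension guarantees that eigenvalues exist. *)
Lemma lambda_boundsP (R : realType) n (A : 'M[R]_n) (a b : R) :
  (0 < n)%N -> A^T = A ->
  (a <= lambda_min A /\ lambda_min A <= lambda_max A /\ lambda_max A <= b) <->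
  (psd (A - a%:M) /\ psd (b%:M - A)).
Proof.
case: n A => // n A _ sA; rewrite -le_lambda_min// -lambda_max_le//.
by split=> [[? [? ?]]|[? ?]]; do ?split => //; exact: lambda_min_le_max.
Qed.

Lemma measurable_lambda_bounds (R : realType) d (T : measurableType d) n
    (A : T -> 'M[R]_n) (a b : R) :
  (0 < n)%N -> meas_mx A -> (forall x, (A x)^T = A x) ->
  measurable [set x | a <= lambda_min (A x) /\
    lambda_min (A x) <= lambda_max (A x) /\ lambda_max (A x) <= b].
Proof.
move=> n0 mA sA; rewrite (_ : [set x | _] =
    [set x | psd (A x - a%:M)] `&` [set x | psd (b%:M - A x)]).
  by apply: measurableI; apply/measurable_psd/meas_mxB => //; exact: meas_mx_cst.
by apply/seteqP; split=> x /=; rewrite lambda_boundsP.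
Qed.

Section Truncation.
Context (R : realType) d (T : measurableType d) (J : nat)
  (u : 'I_J -> T -> R) (L : R).
Hypothesis mu_ : forall j, measurable_fun setT (u j).

Definition truncation_set : set T := [set x | \sum_j u j x ^+ 2 <= L].

(** Zeroing the whole vector where its square norm exceeds [L] turns the essential bound into a
    bound at every point, as [bmeas] demands. *)
Definition truncation (x : T) : 'cV[R]_J := \col_j (u j x * \1_truncation_set x).

Lemma measurable_truncation_set : measurable truncation_set.
Proof.
rewrite (_ : truncation_set = (fun x => \sum_j u j x ^+ 2) @^-1` `]-oo, L]).
  rewrite -[X in measurable X]setTI.
  have : measurable_fun setT (fun x => \sum_j u j x ^+ 2).
    by apply: measurable_sum => j; exact: measurable_funX.
  exact.
by apply/seteqP; split=> x /=; rewrite in_itv.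
Qed.

Lemma truncation_le x : 0 <= L -> sqnorm (truncation x) <= L.
Proof.
move=> L0; rewrite /sqnorm.
under eq_bigr do rewrite mxE exprMn.
rewrite -mulr_suml indicE; have [xD|_] := boolP (x \in truncation_set).
  by rewrite expr1n mulr1; move: xD; rewrite inE.
by rewrite expr0n mulr0.
Qed.

Lemma truncationE x j : truncation_set x -> truncation x j 0 = u j x.
Proof. by move=> xD; rewrite mxE indicE mem_set// mulr1. Qed.

Lemma bmeas_truncation : 0 <= L -> bmeas_mx truncation.
Proof.
move=> L0 j i; rewrite (ord1 i); split.
  under eq_fun do rewrite mxE.
  by apply: measurable_funM => //; exact/measurable_indic/measurable_truncation_set.
exists (L + 1) => x; have := truncation_le x L0.
rewrite /sqnorm (bigD1 j)//= => le.
have le2 : truncation x j 0 ^+ 2 <= L.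
  by apply: le_trans le; rewrite lerDl; apply: sumr_ge0 => k _; exact: sqr_ge0.
rewrite -ler_sqr ?nnegrE ?addr_ge0// real_normK ?num_real//.
by apply: le_trans le2 _; rewrite expr2; nra.
Qed.

End Truncation.

Section EssentialBound.
Context (R : realType) d (T : measurableType d) (mu : {measure set T -> \bar R})
  (mu0 : probability T R) (p0 : T -> R) (J : nat) (u : 'I_J -> T -> R).
Hypothesis mu_ : forall j, measurable_fun setT (u j).
Hypothesis mp0 : measurable_fun setT p0.
Hypothesis mu0E : forall A, measurable A -> mu0 A = (\int[mu]_(x in A) (p0 x)%:E)%E.

Lemma density_null A : measurable A -> mu A = 0%E -> mu0 A = 0%E.
Proof.
move=> mA A0; rewrite mu0E// null_set_integral//.
exact/measurable_EFinP/measurable_funTS.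
Qed.

Lemma ess_sup_truncation :
  let C := ess_sup mu (fun x => ((J%:R)^-1 * \sum_(j < J) u j x ^+ 2)%:E) in
  (0 < J)%N -> (C < +oo)%E ->
  0 <= fine C /\ mu (~` truncation_set u (fine C * J%:R)) = 0%E.
Proof.
move=> C J0 Coo; have JR : 0 < J%:R :> R by rewrite ltr0n.
have [N [mN N0 CN]] := ess_sup_ge mu (fun x => ((J%:R)^-1 * \sum_(j < J) u j x ^+ 2)%:E).
have le x : ~ N x -> (((J%:R)^-1 * \sum_(j < J) u j x ^+ 2)%:E <= C)%E.
  by move=> nN; apply: contrapT => h; apply: nN; exact: CN.
(* The probability [mu0] vanishes on [N], so [N] is not the whole space. A point outside shows
   [0 <= C]; hence [C] is finite and [fine C] is its true value. *)
have [x nNx] : exists x, ~ N x.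
  apply/not_existsP => h; have NT : N = setT.
    by apply/seteqP; split=> // x _; apply: contrapT; exact: h.
  have := density_null mN N0; rewrite NT probability_setT => /eqP.
  by rewrite onee_eq0.
have C0 : (0 <= C)%E.
  apply: le_trans (le x nNx); rewrite lee_fin; apply: mulr_ge0.
    by rewrite invr_ge0 ltW.
  by apply: sumr_ge0 => j _; exact: sqr_ge0.
have CE : C = (fine C)%:E by rewrite fineK// ge0_fin_numE.
split; first exact: fine_ge0.
apply: (subset_measure0 _ mN _ N0).
  by apply: measurableC; exact: measurable_truncation_set.
move=> y ny; apply: contrapT => nNy; apply: ny.
have := le y nNy; rewrite {1}CE lee_fin /truncation_set /=.
by rewrite ler_pdivrMl// mulrC.
Qed.

(** Truncation alters the integrands only on a [mu]-null set, so the Gram matrix of the bounded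
    vectors is still [Sigma]. *)
Lemma gram_truncation (L : R) (Sigma : 'M[R]_J) :
  (forall x, 0 <= p0 x) ->
  (forall j k, Sigma j k = Rintegral mu setT (fun x => u j x * u k x * p0 x)) ->
  0 <= L -> mu (~` truncation_set u L) = 0%E ->
  Sigma = expect_mx mu0 (fun t => truncation u L t *m (truncation u L t)^T).
Proof.
move=> p00 SE L0 N0; have bU := bmeas_truncation mu_ L0.
apply/matrixP => j k; rewrite SE mxE.
have E x : (truncation u L x *m (truncation u L x)^T) j k =
    truncation u L x j 0 * truncation u L x k 0.
  by rewrite mxE big_ord1 [X in _ * X]mxE.
have bjk : bmeas (fun x => truncation u L x j 0 * truncation u L x k 0).
  exact: bmeasM.
under [in RHS]eq_Rintegral => x _ do rewrite E.
rewrite (Rintegral_density mp0 p00 mu0E bjk); congr fine.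
apply: ae_eq_integral => //.
- by apply/measurable_EFinP; do 2!apply: measurable_funM => //.
- by apply/measurable_EFinP/measurable_funM => //; case: bjk.
exists (~` truncation_set u L); split => //.
  by apply: measurableC; exact: measurable_truncation_set.
move=> x h xD; apply: h => _.
by rewrite /= !truncationE.
Qed.

End EssentialBound.

Lemma truncated_dev_sum (R : realType) d (T : measurableType d) J n (u : 'I_J -> T -> R) (L : R)
    (S : 'M[R]_J) (x : 'I_n -> T) : (0 < n)%N ->
  (forall i, truncation_set u L (x i)) ->
  \sum_i rank1_dev S (truncation u L (x i)) = n%:R *: (emp_gram u x - S).
Proof.
move=> n0 xD; rewrite /rank1_dev sumrB sumr_const card_ord scalerBr [n%:R *: S]scaler_nat.
congr (_ - _); apply/matrixP => j k; rewrite summxE !mxE mulrA divff ?mul1r; last first.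
  by rewrite pnatr_eq0 -lt0n.
apply: eq_bigr => i _; rewrite [LHS]mxE big_ord1 [X in _ * X = _]mxE.
by rewrite !truncationE.
Qed.

Lemma opnorm_scale_le (R : realType) n (A : 'M[R]_n) (a t : R) : 0 < a -> 0 <= t ->
  opnorm (a *: A) <= a * t -> opnorm A <= t.
Proof.
move=> a0 t0 le; have at0 : 0 <= a * t by rewrite mulr_ge0// ltW.
have /(opnorm_leP _ at0) h := le; apply/opnorm_leP => // v; have := h v; rewrite -scalemxAl -!sqr_vnorm vnorm_scale.
by rewrite (ger0_norm (ltW a0)) !exprMn -[X in _ <= X -> _]mulrA ler_pM2l// exprn_gt0.
Qed.

Lemma measure_bigsetU0 (R : realType) d (T : measurableType d)
    (P : {measure set T -> \bar R}) (n : nat) (F : 'I_n -> set T) :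
  (forall i, measurable (F i)) -> (forall i, P (F i) = 0%E) ->
  measurable (\big[setU/set0]_i F i) /\ P (\big[setU/set0]_i F i) = 0%E.
Proof.
move=> mF F0; apply: (big_ind (fun A => measurable A /\ P A = 0%E)) => //.
move=> A B [mA A0] [mB B0]; split; first exact: measurableU.
by rewrite measureU0.
Qed.

Theorem theorem2 (R : realType) :
  exists c0 : R, 0 < c0 /\
  forall (d : measure_display) (T : measurableType d)
    (mu : {measure set T -> \bar R})
    (J : nat) (u : 'I_J -> T -> R)
    (mu0 : probability T R) (p0 : T -> R)
    (Sigma : 'M[R]_J) (pm pp : R)
    (n : nat) (dO : measure_display) (Omega : measurableType dO)
    (P : probability Omega R) (X : 'I_n -> Omega -> T),
    (2 <= J)%N ->
    (forall j, measurable_fun setT (u j)) ->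
    (ess_sup mu (fun x => ((J%:R)^-1 * \sum_(j < J) u j x ^+ 2)%:E) < +oo)%E ->
    measurable_fun setT p0 -> (forall x, 0 <= p0 x) ->
    (forall A, measurable A -> mu0 A = (\int[mu]_(x in A) (p0 x)%:E)%E) ->
    (forall j k, Sigma j k = Rintegral mu setT (fun x => u j x * u k x * p0 x)) ->
    0 < pm -> pm <= pp ->
    (forall v : 'cV[R]_J,
        pm * vnorm v ^+ 2 <= (v^T *m Sigma *m v) 0 0 <= pp * vnorm v ^+ 2) ->
    (forall i, measurable_fun setT (X i)) ->
    (forall i A, measurable A -> P (X i @^-1` A) = mu0 A) ->
    mutually_independent P X ->
    let CJ2 := fine (ess_sup mu (fun x => ((J%:R)^-1 * \sum_(j < J) u j x ^+ 2)%:E)) in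
    let Sigma_n := fun w => emp_gram u (fun i => X i w) in
    let lm := pm / 2 in
    let lp := pp + pm / 2 in
    CJ2 * J%:R * ln (J%:R) * (opnorm Sigma)^-1 * (pp / pm) ^+ 2 <= c0 * n%:R ->
    (P [set w | lm <= lambda_min (Sigma_n w) /\
                lambda_min (Sigma_n w) <= lambda_max (Sigma_n w) /\
                lambda_max (Sigma_n w) <= lp]%R
     >= P [set w | opnorm (Sigma_n w - Sigma) <= pm / (2 * pp) * opnorm Sigma]%R)%E /\
    (P [set w | opnorm (Sigma_n w - Sigma) <= pm / (2 * pp) * opnorm Sigma]%R
     >= (1 - expR (1 - c0 * n%:R * (pm / pp) ^+ 2 * opnorm Sigma / (CJ2 * J%:R)))%:E)%E.
Proof.
(* The constant is the rate obtained in [tail_exp]. *)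
exists 400^-1; split; first by rewrite invr_gt0 ltr0n.
move=> d T mu J u mu0 p0 Sigma pm pp n dO Omega P X J2 mU Coo mp0 p00 mu0E SigmaE
  pm0 pmp quadS mX lawX indX CJ2 Sigma_n lm lp hyp.
have J0 : (0 < J)%N by apply: ltnW.
have pp0 : 0 < pp by apply: lt_le_trans pmp.
have [C0 N0] := ess_sup_truncation mU mp0 mu0E J0 Coo.
rewrite -/CJ2 in C0 N0; set L := CJ2 * J%:R in hyp N0 *.
have L0 : 0 <= L by rewrite mulr_ge0.
have SE := gram_truncation mU mp0 mu0E p00 SigmaE L0 N0.
have sS : Sigma^T = Sigma by rewrite SE gram_tr.
have qm : psd (Sigma - pm%:M).
  by apply/psd_sub_scalar => v; have /andP[+ _] := quadS v; rewrite sqr_vnorm.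
have qp : psd (pp%:M - Sigma).
  by apply/psd_scalar_sub => v; have /andP[_ +] := quadS v; rewrite sqr_vnorm.
pose s := opnorm Sigma; pose t := pm / (2 * pp) * s.
have s0 : 0 < s.
  have := quad_le_opnorm Sigma (delta_mx (Ordinal J0) 0); rewrite sqnorm_delta mulr1.
  have /psd_sub_scalar /(_ (delta_mx (Ordinal J0) 0)) := qm.
  rewrite sqnorm_delta mulr1 => h1 h2; apply: lt_le_trans pm0 _.
  by apply: le_trans h1 _; apply: le_trans h2; exact: ler_norm.
have t0 : 0 < t by rewrite mulr_gt0// divr_gt0// mulr_gt0.
have mE1 : measurable [set w | opnorm (Sigma_n w - Sigma) <= t].
  apply: measurable_opnorm_le; first exact: ltW.
  by apply: meas_mxB; [exact: meas_emp_gram|exact: meas_mx_cst].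
have bU := bmeas_truncation mU L0.
(* If [L] were zero, the truncated vectors and hence [Sigma] would vanish, against the lower bound
   [pm > 0]. *)
have Lp : 0 < L.
  rewrite lt_neqAle L0 andbT eq_sym; apply/eqP => Lz.
  have /psd_sub_scalar /(_ (delta_mx (Ordinal J0) 0)) := qm.
  rewrite sqnorm_delta mulr1 leNgt => /negP; apply.
  suff -> : Sigma = 0 by rewrite /quad mulmx0 mul0mx mxE.
  rewrite SE; apply/matrixP => j k; rewrite !mxE -[RHS](expect_cst mu0 0).
  apply: eq_Rintegral => x _.
  have : sqnorm (truncation u L x) == 0.
    by rewrite eq_le sqnorm_ge0 -[X in _ <= X]Lz truncation_le.
  by rewrite sqnorm_eq0 => /eqP ->; rewrite mul0mx mxE.
(* For [n = 0] the sample size condition reads as a positive number at most zero; [J >= 2] enters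
   through [ln J > 0]. *)
have n0 : (0 < n)%N.
  rewrite lt0n; apply/eqP => nz; move: hyp; rewrite nz mulr0 leNgt => /negP; apply.
  have lnJ0 : 0 < ln J%:R :> R by rewrite ln_gt0// ltr1n.
  by do 3?[apply: mulr_gt0 => //]; rewrite ?invr_gt0// exprn_gt0// divr_gt0.
split.
  apply: le_measure; rewrite ?inE//.
    apply: measurable_lambda_bounds => // [|w]; first exact: meas_emp_gram.
    exact: emp_gram_tr.
  move=> w le; apply/lambda_boundsP => //; first exact: emp_gram_tr.
  exact: (psd_of_opnorm_sub sS pm0 pmp qm qp).
pose N := ~` truncation_set u L.
have mN : measurable N by apply: measurableC; exact: measurable_truncation_set.
have mXN i : measurable (X i @^-1` N).
  by rewrite -[X in measurable X]setTI; exact: mX.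
have XN0 i : P (X i @^-1` N) = 0%E.
  by rewrite lawX//; exact: (density_null mp0 mu0E).
have [mNN NN0] := measure_bigsetU0 mXN XN0.
pose k := pp / pm; have k1 : 1 <= k by rewrite ler_pdivlMr// mul1r.
have k0 : 0 < k by apply: lt_le_trans k1.
have nR : 0 < n%:R :> R by rewrite ltr0n.
pose m := n%:R * s / (k ^+ 2 * L).
(* This is the sample size condition multiplied by [s / (k^2 L)]. *)
have lnJ : ln J%:R <= 400^-1 * m.
  have -> : ln J%:R = L * ln J%:R * s^-1 * k ^+ 2 * (s / (k ^+ 2 * L)).
    by field; rewrite !gt_eqF.
  have -> : 400^-1 * m = 400^-1 * n%:R * (s / (k ^+ 2 * L)).
    by rewrite /m; ring.
  by rewrite ler_pM2r// divr_gt0// mulr_gt0// exprn_gt0.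
have tail := tail_exp bU (fun x => truncation_le u x L0) mX lawX indX n0 J0 Lp k1.
rewrite -SE in tail; have {}tail := tail s0 lnJ.
(* Unless some sample point falls in the null set [N], the truncated deviations sum to
   [n (Sigma_n - Sigma)], so a failure of the norm bound is a tail event for that sum. *)
have sub : ~` [set w | opnorm (Sigma_n w - Sigma) <= t] `<=`
    [set w | n%:R * s / (2 * k) < opnorm (\sum_i rank1_dev Sigma (truncation u L (X i w)))]
    `|` \big[setU/set0]_i (X i @^-1` N).
  move=> w /= nle; have [wN|wN] := pselect ((\big[setU/set0]_i (X i @^-1` N)) w); [by right|left].
  rewrite truncated_dev_sum//; last first.
    by move=> i; apply: contrapT => h; apply: wN; rewrite (bigD1 i)//=; left.
  rewrite ltNge; apply/negP => le; apply: nle.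
  apply: (opnorm_scale_le nR (ltW t0)); apply: le_trans le _.
  rewrite /t /k -/s le_eqVlt; apply/orP; left; apply/eqP.
  by field; rewrite !gt_eqF.
have mtail : measurable [set w | n%:R * s / (2 * k) <
    opnorm (\sum_i rank1_dev Sigma (truncation u L (X i w)))].
  have nk0 : 0 < n%:R * s / (2 * k) by apply: divr_gt0; apply: mulr_gt0.
  by rewrite SE; apply: measurable_tail (ltW nk0).
rewrite -[X in (_ <= P X)%E]setCK probability_setC; last exact: measurableC.
rewrite EFinB leeB//.
apply: (@le_trans _ _ (P ([set w | n%:R * s / (2 * k) <
    opnorm (\sum_i rank1_dev Sigma (truncation u L (X i w)))] `|`
    \big[setU/set0]_i (X i @^-1` N)))).
  apply: le_measure => //; rewrite inE; first exact: measurableC.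
  exact: measurableU.
rewrite measureU0//; apply: le_trans tail _; rewrite lee_fin ler_expR lerD2l lerN2.
rewrite -/s le_eqVlt; apply/orP; left; apply/eqP.
by rewrite /k; field; rewrite !gt_eqF.
Qed.
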